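(* For any finite set $\mathcal F$ of $2$-edge-coloured graphs, there is a polynomial-time reduction from the $\mathcal F$-free $2$-edge-colouring problem to $\mathrm{CSP}(\mathbb B_{\mathcal F})$.
   Context: Graphs are finite and simple. A $2$-edge-colouring of $G$ assigns to every edge the colour red ($r$) or blue ($b$), not necessarily properly. A $2$-edge-colouring of $G$ is $\mathcal F$-free if no induced $2$-edge-coloured subgraph is isomorphic (preserving colours) to a member of $\mathcal F$. The $\mathcal F$-free $2$-edge-colouring problem is to decide whether an input graph $G$ admits an $\mathcal F$-free $2$-edge-colouring. For a relational signature $\tau$ and $\tau$-structures $\mathbb A,\mathbb B$ with vertex sets (domains) $V(\mathbb A),V(\mathbb B)$, a homomorphism $\mathbb A\to\mathbb B$ is a map $V(\mathbb A)\to V(\mathbb B)$ preserving all relations of $\tau$. $\mathrm{CSP}(\mathbb B)$ is the problem of deciding whether an input finite $\tau$-structure $\mathbb A$ admits a homomorphism to $\mathbb B$. The structure $\mathbb B_{\mathcal F}$: let $\ell(\mathcal F)$ be the set of all graphs $L$ with vertex set $\{1,\dots,n\}$, for some $n$, that are isomorphic to the underlying (uncoloured) graph of some $F\in\mathcal F$. For each $L\in\ell(\mathcal F)$ the signature contains a relation symbol $R_L$ of arity $\max\{1,|E(L)|\}$. The domain of $\mathbb B_{\mathcal F}$ is $\{r,b\}$. For a graph $L$ with vertex set $\{1,\dots,n\}$ and nonempty edge set, order its edges lexicographically $e_1<\dots<e_m$ ($ab<cd$ iff $\min\{a,b\}<\min\{c,d\}$, or these minima are equal and $\max\{a,b\}<\max\{c,d\}$);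 a $2$-edge-colouring $L'$ of $L$ is encoded by the tuple $c_{L'}\in\{r,b\}^m$ whose $i$-th entry is the colour of $e_i$. For $L\in\ell(\mathcal F)$ with at least one edge, the interpretation of $R_L$ in $\mathbb B_{\mathcal F}$ is the set of all tuples $c_{L'}$ where $L'$ is an $\mathcal F$-free $2$-edge-colouring of $L$; for edgeless $L\in\ell(\mathcal F)$, the interpretation of $R_L$ is empty. *)

(* Defs.v *)
From HB Require Import structures.
From mathcomp Require Import all_boot.

Set Implicit Arguments.
Unset Strict Implicit.
Unset Printing Implicit Defensive.

(** * Multi-tape Turing machines and polynomial-time reductions *)

Inductive direction := Left | Stay | Right.

(* A cell is blank ([None]), a bit ([Some (inl b)]) or one of finitely many
   auxiliary symbols ([Some (inr s)]).  [tm_trans] is a function between finite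
   sets, hence a finite transition table. *)
Definition cell (aux : finType) := option (bool + aux)%type.

Record turing_machine := TuringMachine {
  tm_tapes : nat;  (* the machine has [tm_tapes.+1] tapes *)
  tm_aux : finType;
  tm_state : finType;
  tm_start : tm_state;
  tm_halt : pred tm_state;
  tm_trans : tm_state -> {ffun 'I_tm_tapes.+1 -> cell tm_aux} ->
             tm_state * {ffun 'I_tm_tapes.+1 -> cell tm_aux * direction}
}.

(* A two-way infinite tape: the cells on the left of the head (nearest first),
   the scanned cell, and the cells on the right of the head (nearest first); all
   the cells that are not listed are blank. *)
Record tape (aux : finType) := Tape {
  tape_left : seq (cell aux);
  tape_head : cell aux;
  tape_right : seq (cell aux)
}.

Definition tape_of_seq (aux : finType) (s : seq (cell aux)) : tape aux :=
  Tape [::] (head None s) (behead s).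

Definition write_move (aux : finType) (a : cell aux * direction)
    (t : tape aux) : tape aux :=
  let: Tape l _ r := t in
  match a.2 with
  | Left => Tape (behead l) (head None l) (a.1 :: r)
  | Stay => Tape l a.1 r
  | Right => Tape (a.1 :: l) (head None r) (behead r)
  end.

Fixpoint bit_prefix (aux : finType) (s : seq (cell aux)) : seq bool :=
  if s is Some (inl b) :: s' then b :: bit_prefix s' else [::].

Definition config (M : turing_machine) : Type :=
  tm_state M * {ffun 'I_(tm_tapes M).+1 -> tape (tm_aux M)}.

(* The input is on tape [ord0], with the head on its first bit. *)
Definition init_config (M : turing_machine) (x : seq bool) : config M :=
  (tm_start M,
   [ffun i => tape_of_seq
      (if i == ord0 then [seq Some (inl b) | b <- x] else [::])]).

Definition step (M : turing_machine) (c : config M) : config M :=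
  if tm_halt c.1 then c else
  let: (q, act) := tm_trans c.1 [ffun i => tape_head (c.2 i)] in
  (q, [ffun i => write_move (act i) (c.2 i)]).

(* The output is the maximal word of bits on tape [ord_max] that starts at the
   head. *)
Definition output (M : turing_machine) (c : config M) : seq bool :=
  let t := c.2 ord_max in bit_prefix (tape_head t :: tape_right t).

(* Halting configurations are fixed by [step], so this means: [M] halts on [x]
   after at most [n] steps, with output [y]. *)
Definition computes_within (M : turing_machine) (x y : seq bool) (n : nat) :
    Prop :=
  let c := iter n (@step M) (init_config M x) in tm_halt c.1 /\ output c = y.

Record decision_problem := DecisionProblem {
  instance_of : Type;
  encode : instance_of -> seq bool;
  encode_inj : injective encode;
  yes : instance_of -> Prop
}.

Definition polytime_computable (P Q : decision_problem)
    (f : instance_of P -> instance_of Q) : Prop :=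
  exists (M : turing_machine) (c d : nat), forall x : instance_of P,
    computes_within M (encode x) (encode (f x)) (c * size (encode x) ^ d + c).

Definition polytime_reducible (P Q : decision_problem) : Prop :=
  exists f : instance_of P -> instance_of Q,
    polytime_computable f /\ (forall x, yes x <-> yes (f x)).

(** * Graphs and 2-edge-coloured graphs *)

Definition graph_on (T : finType) :=
  {E : {set {set T}} | [forall e in E, #|e| == 2]}.

Definition edges (T : finType) (G : graph_on T) : {set {set T}} := val G.

Definition isomorphic (T U : finType) (G : graph_on T) (H : graph_on U) : bool :=
  [exists f : {ffun T -> U},
     [&& injectiveb f, [forall y, y \in codom f]
       & [forall e : {set T}, (e \in edges G) == (f @: e \in edges H)]]].

Fact induced_subproof (T : finType) (G : graph_on T) (S : {set T}) :
  [forall e in [set e : {set {x : T | x \in S}} | val @: e \in edges G],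
     #|e| == 2].
Proof.
apply/forall_inP => e; rewrite inE => eG.
by have /forall_inP/(_ _ eG) := valP G; rewrite card_imset //; exact: val_inj.
Qed.

Definition induced (T : finType) (G : graph_on T) (S : {set T}) :
    graph_on {x : T | x \in S} :=
  Sub [set e : {set {x : T | x \in S}} | val @: e \in edges G]
      (induced_subproof G S).

Inductive color := red | blue.

Definition bool_of_color (c : color) : bool := if c is red then true else false.
Definition color_of_bool (b : bool) : color := if b then red else blue.
Lemma bool_of_colorK : cancel bool_of_color color_of_bool.
Proof. by case. Qed.
HB.instance Definition _ := Finite.copy color (can_type bool_of_colorK).

(* Only the values on the edges are meaningful: no definition below looks at the
   colour of a set that is not an edge. *)
Definition coloring (T : finType) := {ffun {set T} -> color}.

Record cgraph := CGraph {
  cvert : finType;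
  cgraph_graph : graph_on cvert;
  cgraph_color : coloring cvert
}.

Definition cisomorphic (G H : cgraph) : bool :=
  [exists f : {ffun cvert G -> cvert H},
     [&& injectiveb f, [forall y, y \in codom f],
         [forall e : {set cvert G},
            (e \in edges (cgraph_graph G)) == (f @: e \in edges (cgraph_graph H))]
       & [forall e in edges (cgraph_graph G),
            cgraph_color G e == cgraph_color H (f @: e)]]].

Definition cinduced (G : cgraph) (S : {set cvert G}) : cgraph :=
  CGraph (induced (cgraph_graph G) S)
         [ffun e : {set {x : cvert G | x \in S}} => cgraph_color G (val @: e)].

Definition is_free (Fs : seq cgraph) (G : cgraph) : bool :=
  all (fun F => [forall S : {set cvert G}, ~~ cisomorphic (cinduced S) F]) Fs.

(** * The F-free 2-edge-colouring problem *)

(* 1^n 0 followed by the adjacency matrix, row by row. *)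
Definition encode_graph (G : {n : nat & graph_on 'I_n}) : seq bool :=
  nseq (tag G) true ++ false ::
  [seq [set i; j] \in edges (tagged G) | i <- enum 'I_(tag G),
                                         j <- enum 'I_(tag G)].

Lemma nseq_true_inj (m n : nat) (s t : seq bool) :
  nseq m true ++ false :: s = nseq n true ++ false :: t -> m = n /\ s = t.
Proof.
elim: m n => [|m IH] [|n] //= [] //.
by move=> /IH [-> ->].
Qed.

Lemma encode_graph_inj : injective encode_graph.
Proof.
move=> [m G] [n H] /nseq_true_inj /= [emn]; case: n / emn H => H eqGH.
congr existT; apply/val_inj/setP => e.
have eqij i j : ([set i; j] \in edges G) = ([set i; j] \in edges H).
  have : [seq [set p.1; p.2] \in edges G
           | p <- [seq (i, j) | i <- enum 'I_m, j <- enum 'I_m]]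
       = [seq [set p.1; p.2] \in edges H
           | p <- [seq (i, j) | i <- enum 'I_m, j <- enum 'I_m]].
    by rewrite !map_allpairs.
  move/eq_in_map/(_ (i, j)); apply; apply/allpairsP; exists (i, j).
  by rewrite !mem_enum.
have card2 K (eK : e \in edges (K : graph_on 'I_m)) : #|e| == 2.
  by have /forall_inP := valP K; apply.
apply/idP/idP => eK; have /cards2P [i [j [_ eij]]] := card2 _ eK;
  by move: eK; rewrite eij -/(edges _) eqij.
Qed.

Definition free_coloring_problem (Fs : seq cgraph) : decision_problem :=
  @DecisionProblem {n : nat & graph_on 'I_n} encode_graph encode_graph_inj
    (fun G => exists c : coloring 'I_(tag G), is_free Fs (CGraph (tagged G) c)).

(** * Relational structures and CSPs *)

Record signature := Signature { symbol : finType; arity : symbol -> nat }.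

Definition structure_on (tau : signature) (D : finType) :=
  {dffun forall R : symbol tau, {set (arity R).-tuple D}}.

Definition is_hom (tau : signature) (D D' : finType) (A : structure_on tau D)
    (B : structure_on tau D') (h : D -> D') : Prop :=
  forall (R : symbol tau) (t : (arity R).-tuple D),
    t \in A R -> map_tuple h t \in B R.

(* The words of length [k] over {0, ..., n-1}, in lexicographic order. *)
Definition words (n k : nat) : seq (seq 'I_n) :=
  iter k (fun W => [seq i :: w | i <- enum 'I_n, w <- W]) [:: [::]].

(* 1^n 0 followed by the characteristic tables of all relations (for a fixed
   finite signature this has length polynomial in the size of the domain). *)
Definition encode_structure (tau : signature)
    (A : {n : nat & structure_on tau 'I_n}) : seq bool :=
  nseq (tag A) true ++ false ::
  flatten [seq [seq w \in [seq tval t | t in tagged A R]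
                 | w <- words (tag A) (arity R)]
            | R <- enum (symbol tau)].

Lemma mem_words (n k : nat) (t : k.-tuple 'I_n) : tval t \in words n k.
Proof.
case: t => s /= /eqP <-; elim: s => [|i s IH] //.
by rewrite /words iterS; apply: allpairs_f; rewrite ?mem_enum.
Qed.

Lemma encode_structure_inj (tau : signature) :
  injective (@encode_structure tau).
Proof.
move=> [m A] [n B] /nseq_true_inj /= [emn]; case: n / emn B => B eqAB.
congr existT; apply/ffunP => R; apply/setP => t.
set a := fun R => [seq w \in [seq tval t | t in A R] | w <- words m (arity R)].
set b := fun R => [seq w \in [seq tval t | t in B R] | w <- words m (arity R)].
have /eq_in_map /(_ R) : map a (enum (symbol tau)) = map b (enum (symbol tau)).
  apply: eq_from_flatten_shape => //.
  by rewrite /shape -!map_comp; apply: eq_map => R' /=; rewrite !size_map.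
rewrite mem_enum => /(_ isT) /eq_in_map /(_ _ (mem_words t)).
by rewrite !(mem_image val_inj).
Qed.

Definition CSP (tau : signature) (D : finType) (B : structure_on tau D) :
    decision_problem :=
  @DecisionProblem {n : nat & structure_on tau 'I_n}
    (@encode_structure tau) (@encode_structure_inj tau)
    (fun A => exists h : 'I_(tag A) -> D, is_hom (tagged A) B h).

(** * The structure B_F *)

(* The vertex set {1, ..., n} is represented by ['I_n] = {0, ..., n-1}; all
   graphs that occur have as many vertices as some member of [Fs], see
   [mem_ell]. *)
Definition ell (Fs : seq cgraph) : seq {n : nat & graph_on 'I_n} :=
  flatten [seq [seq Tagged (fun n => graph_on 'I_n) L
                 | L <- enum {: graph_on 'I_#|cvert F|}
                 & isomorphic L (cgraph_graph F)]
            | F <- Fs].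

Lemma mem_ell (Fs : seq cgraph) (L : {n : nat & graph_on 'I_n}) :
  (L \in ell Fs) = has (fun F => isomorphic (tagged L) (cgraph_graph F)) Fs.
Proof.
rewrite /ell; elim: Fs => [|F Fs IH] //=; rewrite mem_cat IH; congr (_ || _).
apply/mapP/idP => [[L']|isoL]; first by rewrite mem_filter => /andP [? _] ->.
case: L isoL {IH} => n L /= isoL.
have en : n = #|cvert F|.
  have /existsP [f /and3P [/injectiveP injf /forallP surf _]] := isoL.
  rewrite -[LHS]card_ord -(card_codom injf); apply: eq_card => y.
  by rewrite surf inE.
by case: _ / en L isoL => L isoL; exists L; rewrite // mem_filter isoL mem_enum.
Qed.

Definition edge_min (n : nat) (e : {set 'I_n}) : nat := \big[minn/n]_(i in e) i.
Definition edge_max (n : nat) (e : {set 'I_n}) : nat := \max_(i in e) i.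

Definition edge_le (n : nat) (e f : {set 'I_n}) : bool :=
  (edge_min e < edge_min f) ||
  ((edge_min e == edge_min f) && (edge_max e <= edge_max f)).

Definition sorted_edges (n : nat) (L : graph_on 'I_n) : seq {set 'I_n} :=
  sort (@edge_le n) (enum (edges L)).

Definition color_tuple (n : nat) (L : graph_on 'I_n) (c : coloring 'I_n) :
    seq color :=
  [seq c e | e <- sorted_edges L].

Definition sigF (Fs : seq cgraph) : signature :=
  @Signature (seq_sub (ell Fs)) (fun L => maxn 1 #|edges (tagged (val L))|).

Definition structF (Fs : seq cgraph) : structure_on (sigF Fs) color :=
  [ffun R : symbol (sigF Fs) =>
    let L := tagged (val R) in
    if edges L == set0 then set0
    else [set t : (arity R).-tuple color |
           [exists c : coloring 'I_(tag (val R)),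
              is_free Fs (CGraph L c) && (tval t == color_tuple L c)]]].

(* Main.v *)
(* The structure built from a graph [G] on [n] vertices has the domain of all
   pairs over {0, ..., n}, so it is nonempty even when [n = 0].  A tuple is in the
   relation of [L] when some injection of the vertices of [L] identifies [L] with
   an induced subgraph of [G] and maps the edges of [L], each in one of its two
   orientations, to the entries of the tuple.  A colouring of [G] then gives a
   homomorphism by colouring both codes of an edge alike, and a homomorphism gives
   a colouring by choosing one code per edge.

   Every bit of the encoded structure is decided by nested loops over vertices
   that test equality and adjacency.  A vertex is stored as the position of a head
   on a tape that carries 1^n 0; adjacency is looked up by scanning the whole
   matrix from right to left.  All loops run downwards, so that the output is
   written from right to left and the output head ends next to its first bit. *)
Require Import Defs.
From mathcomp Require Import all_boot.
From mathcomp Require Import zify.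

Set Implicit Arguments.
Unset Strict Implicit.
Unset Printing Implicit Defensive.

(** * Program fragments *)

(** Since [Fs] is fixed, the table of a graph [L] with k vertices and arity m is printed by 2m + k
    nested loops, a depth that does not depend on the input; this is what makes the running time
    polynomial. A homomorphism may colour the two codes of an edge differently. This is harmless:
    the constraints range over all choices of orientations, so those on the chosen codes are among
    them. When [L] has an edge, only codes of edges of [G] occur in its tuples. The delicate case is
    an edgeless [L]. Its relation in the target is empty, so a single placement of [L] in [G] has to
    exclude every homomorphism. It does, because all tuples of length 1 then belong to the relation
    of [L], provided that the domain has an element. If [Fs] contains the graph without vertices and
    [G] is empty too, only the additional coordinate n supplies one. *)

Section Fragments.

Variable R : finType.

Definition tapes := {ffun R -> tape void}.
Definition reads := {ffun R -> cell void}.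

(** A fragment is left by a transition without target state, which still acts on the tapes.
    Sequencing redirects this transition to the start of the next fragment, so it costs no step. *)
Record frag := Frag {
  fstate : finType;
  fstart : fstate;
  fdelta : fstate -> reads -> option fstate * {ffun R -> cell void * direction}
}.

Definition heads (T : tapes) : reads := [ffun r => tape_head (T r)].
Definition move (a : {ffun R -> cell void * direction}) (T : tapes) : tapes :=
  [ffun r => write_move (a r) (T r)].

Inductive exits (F : frag) : fstate F -> tapes -> tapes -> nat -> Prop :=
| ExitsNow s T a :
    fdelta s (heads T) = (None, a) -> exits s T (move a T) 1
| ExitsLater s s' a T T' k :
    fdelta s (heads T) = (Some s', a) -> exits s' (move a T) T' k ->
    exits s T T' k.+1.

Definition runs (F : frag) (T T' : tapes) (t : nat) : Prop :=
  exists2 k, k <= t & exits (fstart F) T T' k.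

Lemma runs_le F T T' t t' : t <= t' -> runs F T T' t -> runs F T T' t'.
Proof. by move=> le [k kt e]; exists k => //; apply: leq_trans le. Qed.

Definition stay (r : reads) : {ffun R -> cell void * direction} :=
  [ffun i => (r i, Stay)].

Lemma write_move_stay (t : tape void) : write_move (tape_head t, Stay) t = t.
Proof. by case: t. Qed.

Lemma move_stay T : move (stay (heads T)) T = T.
Proof. by apply/ffunP => r; rewrite !ffunE write_move_stay. Qed.

Definition fact (a : R -> cell void -> cell void * direction) : frag :=
  @Frag unit tt (fun _ r => (None, [ffun i => a i (r i)])).

Definition fseq (F G : frag) : frag :=
  @Frag (fstate F + fstate G)%type (inl (fstart F))
    (fun s r => match s with
       | inl s => let: (o, a) := fdelta s r in
                  (Some (if o is Some s' then inl s' else inr (fstart G)), a)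
       | inr s => let: (o, a) := fdelta s r in (omap inr o, a)
       end).

Definition fif (b : reads -> bool) (F G : frag) : frag :=
  @Frag (option (fstate F + fstate G)) None
    (fun s r => match s with
       | None => (Some (Some (if b r then inl (fstart F) else inr (fstart G))),
                  stay r)
       | Some (inl s) => let: (o, a) := fdelta s r in (omap (Some \o inl) o, a)
       | Some (inr s) => let: (o, a) := fdelta s r in (omap (Some \o inr) o, a)
       end).

Definition fwhile (b : reads -> bool) (F : frag) : frag :=
  @Frag (option (fstate F)) None
    (fun s r => match s with
       | None => (if b r then Some (Some (fstart F)) else None, stay r)
       | Some s => let: (o, a) := fdelta s r in (Some o, a)
       end).

Lemma runs_act a T :
  runs (fact a) T [ffun r => write_move (a r (tape_head (T r))) (T r)] 1.
Proof.
exists 1 => //.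
have -> : [ffun r => write_move (a r (tape_head (T r))) (T r)]
        = move [ffun i => a i (heads T i)] T.
  by apply/ffunP => r; rewrite !ffunE.
exact: ExitsNow.
Qed.

Lemma runs_seq F G T T1 T2 t t' :
  runs F T T1 t -> runs G T1 T2 t' -> runs (fseq F G) T T2 (t + t').
Proof.
case=> k le e [k' le' e']; exists (k + k'); first exact: leq_add.
have {le' e'} e' : @exits (fseq F G) (inr (fstart G)) T1 T2 k'.
  elim: e' {e le le'} => {T1 T2 k'} [s T1 a e1|s s' a T1 T2 k' e1 _ IH].
    by apply: ExitsNow; rewrite /= e1.
  by apply: ExitsLater IH; rewrite /= e1.
rewrite /=; elim: e e' {le} => {T T1 k} [s T a e1|s s' a T T1 k e1 _ IH] e'.
  by apply: ExitsLater e'; rewrite /= e1.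
by apply: ExitsLater (IH e'); rewrite /= e1.
Qed.

Lemma runs_if (b : reads -> bool) F G T T' t :
  runs (if b (heads T) then F else G) T T' t -> runs (fif b F G) T T' t.+1.
Proof.
case=> k le e; exists k.+1 => //.
apply: (@ExitsLater (fif b F G) None _ (stay (heads T))) => //=.
rewrite move_stay; case: (b _) e => e.
  elim: e => {T T' k le} [s T a e1|s s' a T T' k e1 _ IH].
    by apply: ExitsNow; rewrite /= e1.
  by apply: ExitsLater IH; rewrite /= e1.
elim: e => {T T' k le} [s T a e1|s s' a T T' k e1 _ IH].
  by apply: ExitsNow; rewrite /= e1.
by apply: ExitsLater IH; rewrite /= e1.
Qed.

Lemma runs_while0 (b : reads -> bool) F T : ~~ b (heads T) -> runs (fwhile b F) T T 1.
Proof.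
move=> nb; exists 1 => //; rewrite -{2}(move_stay T).
by apply: ExitsNow => /=; rewrite (negbTE nb).
Qed.

Lemma runs_whileS (b : reads -> bool) F T T1 T2 t t' : b (heads T) -> runs F T T1 t ->
  runs (fwhile b F) T1 T2 t' -> runs (fwhile b F) T T2 (t + t').+1.
Proof.
move=> bT [k le e] [k' le' e']; exists (k + k').+1; first exact: leq_add.
apply: (@ExitsLater (fwhile b F) None (Some (fstart F)) (stay (heads T))).
  by rewrite /= bT.
rewrite move_stay.
elim: e e' {le bT} => {T T1 k} [s T a e1|s s' a T T1 k e1 _ IH] e'.
  by apply: ExitsLater e'; rewrite /= e1.
by apply: ExitsLater (IH e'); rewrite /= e1.
Qed.

(** The index of [S] counts the iterations that are left. Every iteration pays one step for its
    test, and the failing test is the last step. *)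
Lemma runs_while (b : reads -> bool) F t (S : nat -> tapes) k :
  (forall i, i < k -> b (heads (S i.+1)) /\ runs F (S i.+1) (S i) t) ->
  ~~ b (heads (S 0)) -> runs (fwhile b F) (S k) (S 0) (k * t.+1).+1.
Proof.
move=> H nb; elim: k H => [|k IH] H; first exact: runs_while0.
have [bk rk] := H k (ltnSn k); rewrite mulSn addSnnS.
by apply: runs_whileS bk rk (IH _) => i ik; apply: H; apply: ltnW.
Qed.

End Fragments.

(** * Tapes as words with a head position *)

Section Zipper.

(** Tapes are compared as lists, so a listed blank differs from an unlisted one. Stepping left from
    beyond the end of [c] would leave a listed blank behind, which explains the bound in
    [zipper_left]. *)
Definition zipper (c : seq (cell void)) (p : nat) : tape void :=
  Tape (rev (take p c)) (nth None c p) (drop p.+1 c).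

Lemma zipper_right c p :
  p < size c -> write_move (nth None c p, Right) (zipper c p) = zipper c p.+1.
Proof.
move=> lt; rewrite /zipper /= (take_nth None lt) rev_rcons.
congr (Tape _ _ _); first by rewrite -nth0 nth_drop addn0.
by rewrite -drop1 drop_drop.
Qed.

Lemma zipper_left c p : p.+1 < size c ->
  write_move (nth None c p.+1, Left) (zipper c p.+1) = zipper c p.
Proof.
move=> lt; rewrite /zipper /= (take_nth None (ltnW lt)) rev_rcons /=.
by rewrite -(drop_nth None lt).
Qed.

End Zipper.

(** * Polynomial bounds *)

(* A function of the number of vertices, hence [n.+1]: it is positive. *)
Definition polynomial (T : nat -> nat) : Prop :=
  exists c d, forall n, T n <= c * n.+1 ^ d.

Lemma polynomial_le T T' : (forall n, T n <= T' n) -> polynomial T' -> polynomial T.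
Proof.
by move=> le [c [d H]]; exists c, d => n; apply: leq_trans (le n) (H n).
Qed.

Lemma polynomial_const k : polynomial (fun=> k).
Proof. by exists k, 0 => n; rewrite muln1. Qed.

Lemma polynomialS : polynomial S.
Proof. by exists 1, 1 => n; rewrite mul1n expn1. Qed.

Lemma polynomialD T T' :
  polynomial T -> polynomial T' -> polynomial (fun n => T n + T' n).
Proof.
move=> [c [d H]] [c' [d' H']]; exists (c + c'), (d + d') => n.
rewrite mulnDl; apply: leq_add; [apply: leq_trans (H n) _|apply: leq_trans (H' n) _];
  by rewrite leq_mul2l leq_pexp2l ?leq_addr ?leq_addl ?orbT.
Qed.

Lemma polynomialM T T' :
  polynomial T -> polynomial T' -> polynomial (fun n => T n * T' n).
Proof.
move=> [c [d H]] [c' [d' H']]; exists (c * c'), (d + d') => n.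
by rewrite expnD mulnACA leq_mul.
Qed.

(** * Tapes and loops *)

Definition bit (b : bool) : cell void := Some (inl b).

Section Machine.

Variable X : finType.

(* The input tape, the output tape, one tape per variable and two flags. *)
Notation role := (option (option (X + bool))).
Notation frag := (frag role).
Notation env := {ffun X -> nat}.
Notation invar x := (Some (Some (inl x)) : role).
Notation inflag f := (Some (Some (inr f)) : role).

Implicit Types (e : env) (x : X).

Definition upd (e : env) (x : X) (i : nat) : env :=
  [ffun y => if y == x then i else e y].

Lemma updE e x i y : upd e x i y = if y == x then i else e y.
Proof. by rewrite ffunE. Qed.

Lemma upd_upd e x i j : upd (upd e x i) x j = upd e x j.
Proof. by apply/ffunP => y; rewrite !updE; case: eqP. Qed.

Lemma upd_id e x i : e x = i -> upd e x i = e.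
Proof. by move=> <-; apply/ffunP => y; rewrite updE; case: eqP => // ->. Qed.

Record data := Data { flag : bool -> bool; ipos : nat; out : seq bool }.

(* A variable with value [p] is a head at distance [p] from the blank cell on
   the left of a copy of the word 1^n 0. *)
Definition ruler (n : nat) : seq (cell void) :=
  None :: rcons (nseq n (bit true)) (bit false).

Lemma size_ruler n : size (ruler n) = n.+2.
Proof. by rewrite /= size_rcons size_nseq. Qed.

Lemma nth_ruler0 n p : p <= n.+1 -> (nth None (ruler n) p == None) = (p == 0).
Proof.
case: p => [|p] // pn; rewrite /= nth_rcons size_nseq nth_nseq.
by case: (ltngtP p n) => // ?; lia.
Qed.

Lemma nth_ruler_last n p :
  p <= n.+1 -> (nth None (ruler n) p == bit false) = (p == n.+1).
Proof.
case: p => [|p] // pn; rewrite /= nth_rcons size_nseq nth_nseq eqSS.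
by case: (ltngtP p n) => // ?; lia.
Qed.

(** The blank behind the word is listed because scans of the matrix start there and move left. *)
Definition input_tape (s : seq bool) (p : nat) : tape void :=
  zipper (rcons (map bit s) None) p.

Definition output_tape (s : seq bool) : tape void := Tape [::] None (map bit s).

Definition flag_tape (b : bool) : tape void :=
  Tape [::] (if b then bit true else None) [::].

Definition raw (n : nat) (s : seq bool) (e : env) (p : data) : tapes role :=
  [ffun r : role => match r with
   | None => input_tape s (ipos p)
   | Some None => output_tape (out p)
   | Some (Some (inl x)) => zipper (ruler n) (e x)
   | Some (Some (inr f)) => flag_tape (flag p f)
   end].

(** All heads move in the same step, so that one loop can shift a value between variables. [D] takes
    precedence over [I]. *)
Definition vmove (D I : pred X) : frag :=
  fact (fun r c => (c, if r is Some (Some (inl x)) then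
                         if D x then Left else if I x then Right else Stay
                       else Stay)).

Definition imove (d : direction) : frag :=
  fact (fun r c => (c, if r is None then d else Stay)).

Definition setflag (f : bool) (b : bool) : frag :=
  fact (fun r c => (if r == inflag f then if b then bit true else None else c,
                    Stay)).

Definition emit (b : bool) : frag :=
  fact (fun r c => if r is Some None then (bit b, Left) else (c, Stay)).

Definition nop : frag := vmove pred0 pred0.

Definition is0 (x : X) (r : reads role) : bool := r (invar x) == None.
Definition is_last (x : X) (r : reads role) : bool := r (invar x) == bit false.
Definition is_set (f : bool) (r : reads role) : bool := r (inflag f) == bit true.
Definition reads_bit (c : cell void) (r : reads role) : bool := r None == c.

Implicit Type p : data.

Section Size.

Variables (n : nat) (s : seq bool).

Notation raw := (raw n s).

Definition bounded (e : env) : Prop := forall x, e x <= n.+1.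

Lemma is0E x e p : bounded e -> is0 x (heads (raw e p)) = (e x == 0).
Proof. by move=> be; rewrite /is0 !ffunE /= nth_ruler0. Qed.

Lemma is_lastE x e p : bounded e -> is_last x (heads (raw e p)) = (e x == n.+1).
Proof. by move=> be; rewrite /is_last !ffunE /= nth_ruler_last. Qed.

Lemma is_setE f e p : is_set f (heads (raw e p)) = flag p f.
Proof. by rewrite /is_set !ffunE /=; case: (flag p f). Qed.

Lemma reads_bitE c e p :
  reads_bit c (heads (raw e p)) = (nth None (map bit s) (ipos p) == c).
Proof.
rewrite /reads_bit !ffunE /= nth_rcons size_map.
by case: ltngtP => // le; rewrite nth_default // size_map // ?le // ltnW.
Qed.

Lemma runs_vmove (D I : pred X) e p :
  (forall x, D x -> 0 < e x <= n.+1) -> (forall x, ~~ D x -> I x -> e x <= n) ->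
  runs (vmove D I) (raw e p)
    (raw [ffun x => if D x then (e x).-1 else if I x then (e x).+1 else e x] p) 1.
Proof.
move=> hD hI.
have := runs_act (fun r c => (c, if r is Some (Some (inl x)) then
                         if D x then Left else if I x then Right else Stay
                       else Stay)) (raw e p).
congr (runs _ _ _ _); apply/ffunP => -[[[x|f]|]|]; rewrite !ffunE //=;
  try exact: write_move_stay.
have := hD x; have := hI x; case: (D x) => /= [_|+ _].
  move=> /(_ isT); case: (e x) => [|v] //= vn.
  by apply: (@zipper_left (ruler n) v); rewrite size_ruler ltnS.
case: (I x) => [/(_ isT isT) le|_]; last by [].
by apply: (@zipper_right (ruler n) (e x)); rewrite size_ruler ltnS ltnW.
Qed.

Lemma runs_nop e p : runs nop (raw e p) (raw e p) 1.
Proof.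
have := @runs_vmove pred0 pred0 e p; rewrite /nop /=.
have -> : [ffun x => e x] = e by apply/ffunP => x; rewrite ffunE.
exact.
Qed.

Lemma runs_dec x e p : 0 < e x <= n.+1 ->
  runs (vmove (pred1 x) pred0) (raw e p) (raw (upd e x (e x).-1) p) 1.
Proof.
move=> ex; have := @runs_vmove (pred1 x) pred0 e p.
have -> : [ffun y => if pred1 x y then (e y).-1 else if pred0 y then (e y).+1 else e y]
  = upd e x (e x).-1 by apply/ffunP => y; rewrite !ffunE /=; case: eqP => // ->.
by apply=> // y /eqP ->.
Qed.

Lemma runs_inc x e p : e x <= n ->
  runs (vmove pred0 (pred1 x)) (raw e p) (raw (upd e x (e x).+1) p) 1.
Proof.
move=> ex; have := @runs_vmove pred0 (pred1 x) e p.
have -> : [ffun y => if pred0 y then (e y).-1 else if pred1 x y then (e y).+1 else e y]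
  = upd e x (e x).+1 by apply/ffunP => y; rewrite !ffunE /=; case: eqP => // ->.
by apply=> // y _ /eqP ->.
Qed.

Lemma runs_ileft e f i o : i < size s ->
  runs (imove Left) (raw e (Data f i.+1 o)) (raw e (Data f i o)) 1.
Proof.
move=> lt; have := runs_act (fun (r : role) c => (c, if r is None then Left else Stay))
  (raw e (Data f i.+1 o)).
congr (runs _ _ _ _); apply/ffunP => -[[[x|g]|]|]; rewrite !ffunE //=;
  try exact: write_move_stay.
by apply: (@zipper_left (rcons _ _) i); rewrite size_rcons size_map.
Qed.

Lemma runs_iright e f i o : i < size s ->
  runs (imove Right) (raw e (Data f i o)) (raw e (Data f i.+1 o)) 1.
Proof.
move=> lt; have := runs_act (fun (r : role) c => (c, if r is None then Right else Stay))
  (raw e (Data f i o)).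
congr (runs _ _ _ _); apply/ffunP => -[[[x|g]|]|]; rewrite !ffunE //=;
  try exact: write_move_stay.
by apply: (@zipper_right (rcons _ _) i); rewrite size_rcons size_map ltnS ltnW.
Qed.

Definition with_flag (p : data) (f b : bool) : data :=
  Data (fun g => if g == f then b else flag p g) (ipos p) (out p).

Lemma raw_ext e p q : flag p =1 flag q -> ipos p = ipos q -> out p = out q ->
  raw e p = raw e q.
Proof.
move=> ef ei eo; apply/ffunP => -[[[x|f]|]|]; by rewrite !ffunE ?ef ?ei ?eo.
Qed.

Lemma runs_setflag f b e p :
  runs (setflag f b) (raw e p) (raw e (with_flag p f b)) 1.
Proof.
have := runs_act (fun r c =>
  (if r == inflag f then if b then bit true else None else c, Stay)) (raw e p).
congr (runs _ _ _ _); apply/ffunP => -[[[x|g]|]|]; rewrite !ffunE //=.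
by rewrite (inj_eq Some_inj) (inj_eq Some_inj) (inj_eq inr_inj); case: eqP.
Qed.

Lemma runs_emit b e f i o :
  runs (emit b) (raw e (Data f i o)) (raw e (Data f i (b :: o))) 1.
Proof.
have := runs_act (fun (r : role) c => if r is Some None then (bit b, Left) else (c, Stay))
  (raw e (Data f i o)).
congr (runs _ _ _ _); apply/ffunP => -[[[x|g]|]|]; rewrite !ffunE //=;
  exact: write_move_stay.
Qed.

End Size.

(** The head of [x] is driven to the far end of its ruler and then back to 0, its value before the
    loop. The indices are n, ..., 1, preceded by n+1 when [full] holds: vertices need the former,
    coordinates of codes the latter. *)
Definition for_ (x : X) (full : bool) (body : frag) : frag :=
  fseq (vmove pred0 (pred1 x))
    (fseq (fwhile (fun r => ~~ is_last x r) (vmove pred0 (pred1 x)))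
       (fseq (if full then nop else vmove (pred1 x) pred0)
          (fwhile (fun r => ~~ is0 x r) (fseq body (vmove (pred1 x) pred0))))).

Definition for_time (n t : nat) : nat := 2 * n + 3 + (n + 1) * (t + 2) + 1.

Lemma bounded_upd n e x i : i <= n.+1 -> bounded n e -> bounded n (upd e x i).
Proof. by move=> le be y; rewrite updE; case: eqP. Qed.

(** [S i] is the data when the indices 1, ..., i are still to come. *)
Lemma runs_for n s x (full : bool) body e (S : nat -> data) t :
  bounded n e -> e x = 0 ->
  (forall i, i < n + full ->
     runs body (raw n s (upd e x i.+1) (S i.+1)) (raw n s (upd e x i.+1) (S i)) t) ->
  runs (for_ x full body) (raw n s e (S (n + full))) (raw n s e (S 0))
    (for_time n t).
Proof.
move=> be ex H.
have bu i : i <= n.+1 -> bounded n (upd e x i) by move=> le; apply: bounded_upd.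
pose p := S (n + full).
have inc i : i <= n -> runs (vmove pred0 (pred1 x)) (raw n s (upd e x i) p)
    (raw n s (upd e x i.+1) p) 1.
  move=> le; have := @runs_inc n s x (upd e x i) p.
  by rewrite updE eqxx upd_upd; apply.
have dec i q : i <= n -> runs (vmove (pred1 x) pred0) (raw n s (upd e x i.+1) q)
    (raw n s (upd e x i) q) 1.
  move=> le; have := @runs_dec n s x (upd e x i.+1) q.
  by rewrite updE eqxx upd_upd; apply.
have up : runs (fwhile (fun r => ~~ is_last x r) (vmove pred0 (pred1 x)))
    (raw n s (upd e x 1) p) (raw n s (upd e x n.+1) p) (n * 2).+1.
  have := @runs_while _ (fun r => ~~ is_last x r) (vmove pred0 (pred1 x)) 1
    (fun i => raw n s (upd e x (n.+1 - i)) p) n.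
  rewrite subSnn subn0; apply => [i lt|]; last first.
    by rewrite is_lastE ?updE ?eqxx //; apply: bu.
  rewrite is_lastE ?updE ?eqxx; last by apply: bu; rewrite leq_subr.
  split; first by lia.
  by rewrite subSS subSn ?(ltnW lt) //; apply: inc; rewrite leq_subr.
have dn k : k <= n + full ->
   runs (fwhile (fun r => ~~ is0 x r) (fseq body (vmove (pred1 x) pred0)))
    (raw n s (upd e x k) (S k)) (raw n s (upd e x 0) (S 0)) (k * (t + 1).+1).+1.
  have le1 : n + full <= n.+1 by case: (full); lia.
  move=> le; apply: (@runs_while _ _ _ _ (fun i => raw n s (upd e x i) (S i)))
    => [i lt|]; last by rewrite is0E ?updE ?eqxx //; apply: bu.
  have li : i.+1 <= n.+1 by lia.
  rewrite is0E ?updE ?eqxx; last exact: bu.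
  split=> //; apply: runs_seq (H i _) (dec i _ _); lia.
rewrite -{1 2}(upd_id ex).
apply: (@runs_le _ _ _ _ (1 + ((n * 2).+1 + (1 + ((n + full) * (t + 1).+1).+1)))).
  by rewrite /for_time; case: (full); nia.
apply: runs_seq (inc 0 _) (runs_seq up (runs_seq _ (dn _ (leqnn _)))) => //.
rewrite -/p; case: (full) => /=; first by rewrite addn1; apply: runs_nop.
by rewrite addn0; apply: dec.
Qed.

End Machine.

(** * Deciding equality and adjacency *)

Lemma polynomial_for T : polynomial T -> polynomial (fun n => for_time n (T n)).
Proof.
move=> pT; apply: (@polynomial_le _ (fun n => 2 * n.+1 + 3 + n.+1 * (T n + 2) + 1)).
  by move=> n; rewrite /for_time; nia.
apply: polynomialD (polynomial_const 1).
apply: polynomialD.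
  apply: polynomialD (polynomial_const _).
  exact: polynomialM (polynomial_const _) polynomialS.
apply: (polynomialM polynomialS); exact: polynomialD pT (polynomial_const _).
Qed.

Lemma nth_flatten_rows (A : Type) (x0 : A) (m : nat) (ss : seq (seq A)) i j :
  all (fun s => size s == m) ss -> i < size ss -> j < m ->
  nth x0 (flatten ss) (i * m + j) = nth x0 (nth [::] ss i) j.
Proof.
elim: ss i => [|s ss IH] [|i] //= /andP [/eqP sm am] lt jm; rewrite nth_cat sm.
  by rewrite mul0n add0n jm.
by rewrite mulSn -addnA ltnNge leq_addr /= addKn IH.
Qed.

Lemma index_lt n i j : i < n -> j < n -> i * n + j < n * n.
Proof.
move=> lin ljn; apply: (@leq_trans (i.+1 * n)); last by rewrite leq_mul2r lin orbT.
by rewrite mulSnr ltn_add2l.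
Qed.

Definition graph := {n : nat & graph_on 'I_n}.

Lemma size_encode_graph (G : graph) :
  size (encode_graph G) = (tag G).+1 + tag G * tag G.
Proof.
by rewrite /encode_graph size_cat size_nseq /= size_allpairs size_enum_ord addSnnS.
Qed.

Lemma nth_encode_graph (G : graph) (i j : 'I_(tag G)) :
  nth false (encode_graph G) ((tag G).+1 + i * tag G + j)
    = ([set i; j] \in edges (tagged G)).
Proof.
rewrite /encode_graph nth_cat size_nseq ltnNge -addnA addSn ltnW ?leq_addr //=.
rewrite -addnS addKn /= (@nth_flatten_rows _ _ (tag G)) //.
- rewrite (nth_map i) ?size_enum_ord //.
  by rewrite (nth_map j) ?size_enum_ord // !nth_ord_enum.
- by apply/allP => r /mapP [k _ ->]; rewrite size_map size_enum_ord.
- by rewrite size_map size_enum_ord.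
Qed.

(** Stored values are shifted by one, since 0 is the resting value of a variable: [i.+1] stands for
    the vertex [i]. *)
Definition adjacent (G : graph) (p q : nat) : bool :=
  [exists i : 'I_(tag G), exists j : 'I_(tag G),
    [&& i.+1 == p, j.+1 == q & [set i; j] \in edges (tagged G)]].

Section Conditions.

Variables (X : finType) (tmp u v : X).
Hypothesis uniq_special : uniq [:: tmp; u; v].

Notation role := (option (option (X + bool))).
Notation frag := (frag role).
Notation env := {ffun X -> nat}.

Implicit Types (e : env) (x y : X) (A B F : frag) (Z : tapes role).
Implicit Types (p : data) (w : bool * seq bool).

Let neq_special : [/\ tmp != u, tmp != v & u != v].
Proof. by move: uniq_special; rewrite /= !inE negb_or andbT -andbA => /and3P. Qed.

(** A condition receives both continuations, so its outcome lives in the control state. Draining [x]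
    and [y] together into [tmp] ends with both at 0 exactly when they were equal. The test must
    precede the restoration, which therefore appears in each branch. *)
Definition ceq x y A B : frag :=
  fseq (fwhile (fun r => ~~ is0 x r && ~~ is0 y r) (vmove (pred2 x y) (pred1 tmp)))
    (fif (fun r => is0 x r && is0 y r)
       (fseq (fwhile (fun r => ~~ is0 tmp r) (vmove (pred1 tmp) (pred2 x y))) A)
       (fseq (fwhile (fun r => ~~ is0 tmp r) (vmove (pred1 tmp) (pred2 x y))) B)).

Definition eq_time (n : nat) : nat := 4 * n + 7.

Lemma runs_ceq n s e p x y A B Z t :
  bounded n e -> e tmp = 0 -> x != tmp -> y != tmp ->
  runs (if e x == e y then A else B) (raw n s e p) Z t ->
  runs (ceq x y A B) (raw n s e p) Z (eq_time n + t).
Proof.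
move=> be e0 xt yt rAB; pose d := minn (e x) (e y).
(* The environment after [j] units have been moved to [tmp]; [x] and [y] may be the same
   variable. *)
pose E j : env := [ffun z => if z == tmp then j
  else if (z == x) || (z == y) then e z - j else e z].
have Et j : E j tmp = j by rewrite ffunE eqxx.
have Ex j : E j x = e x - j by rewrite ffunE (negbTE xt) eqxx.
have Ey j : E j y = e y - j by rewrite ffunE (negbTE yt) eqxx orbT.
have dx : d <= e x by rewrite geq_minl.
have dy : d <= e y by rewrite geq_minr.
have dn : d <= n.+1 by apply: leq_trans dx (be x).
have bE j : j <= d -> bounded n (E j).
  move=> jd z; rewrite ffunE; case: eqP => _; first exact: leq_trans jd dn.
  by case: ifP => _; rewrite ?(leq_trans (leq_subr _ _)).
have E0 : E 0 = e.
  by apply/ffunP => z; rewrite ffunE subn0 if_same; case: eqP => // ->.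
have dwn j : j < d -> runs (vmove (pred2 x y) (pred1 tmp)) (raw n s (E j) p)
    (raw n s (E j.+1) p) 1.
  move=> jd; have := @runs_vmove _ n s (pred2 x y) (pred1 tmp) (E j) p.
  set W := [ffun z => _]; have -> : W = E j.+1.
    apply/ffunP => z; rewrite !ffunE /=; case: (eqVneq z tmp) => [->|_].
      by rewrite eq_sym (negbTE xt) eq_sym (negbTE yt).
    by case: (_ || _); lia.
  apply=> z /=; last by move=> _ /eqP ->; rewrite Et; lia.
  have := bE j (ltnW jd) z.
  by move=> -> /orP [] /eqP ->; rewrite andbT ?Ex ?Ey; lia.
have upw j : j < d -> runs (vmove (pred1 tmp) (pred2 x y)) (raw n s (E j.+1) p)
    (raw n s (E j) p) 1.
  move=> jd; have := @runs_vmove _ n s (pred1 tmp) (pred2 x y) (E j.+1) p.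
  set W := [ffun z => _]; have -> : W = E j.
    apply/ffunP => z; rewrite !ffunE /=; case: (eqVneq z tmp) => [_|_] //.
    case: (boolP (_ || _)) => // /orP [] /eqP ->; lia.
  apply=> z /=; first by move=> /eqP ->; rewrite Et; lia.
  have bz := be z; move=> zt zxy; rewrite ffunE (negbTE zt) zxy.
  by case/orP: zxy bz => /eqP ->; lia.
have loop1 : runs (fwhile (fun r => ~~ is0 x r && ~~ is0 y r)
    (vmove (pred2 x y) (pred1 tmp))) (raw n s e p) (raw n s (E d) p) (d * 2).+1.
  have := @runs_while _ (fun r => ~~ is0 x r && ~~ is0 y r)
    (vmove (pred2 x y) (pred1 tmp)) 1 (fun i => raw n s (E (d - i)) p) d.
  rewrite subnn subn0 E0; apply=> [i id|]; last by rewrite !is0E ?Ex ?Ey /d; [lia|exact: bE..].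
  rewrite !is0E ?Ex ?Ey; try by apply: bE; rewrite leq_subr.
  split; first lia.
  by rewrite subnS; have := @dwn (d - i).-1; rewrite prednK ?subn_gt0 //; apply; lia.
have loop2 : runs (fwhile (fun r => ~~ is0 tmp r)
    (vmove (pred1 tmp) (pred2 x y))) (raw n s (E d) p) (raw n s e p) (d * 2).+1.
  rewrite -E0; apply: (@runs_while _ _ _ _ (fun i => raw n s (E i) p)) => [i id|];
    rewrite is0E ?Et //; [by split=> //; apply: upw|exact: bE|exact: bE].
apply: (@runs_le _ _ _ _ ((d * 2).+1 + ((d * 2).+1 + t).+1)).
  by rewrite /eq_time; lia.
apply: runs_seq loop1 (runs_if _); rewrite !is0E ?Ex ?Ey; try exact: bE.
have -> : (e x - d == 0) && (e y - d == 0) = (e x == e y) by rewrite /d; lia.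
by case: (_ == _) rAB => rAB; apply: runs_seq loop2 rAB.
Qed.

Definition bit_test x y : frag :=
  fseq (imove _ Left)
    (fif (reads_bit (bit true))
       (ceq u x (ceq v y (setflag _ true true) (nop _)) (nop _)) (nop _)).

(** The head moves left by one cell per pass, in step with the counters [u] and [v], so these always
    name the scanned matrix entry and no address has to be computed. *)
Definition cadj x y A B : frag :=
  fseq (for_ u false (for_ v false (bit_test x y)))
    (fseq (fwhile (fun r => ~~ reads_bit None r) (imove _ Right))
       (fif (is_set true) (fseq (setflag _ true false) A) B)).

(** Between tests the input head rests on the blank behind the input and the flag [true], which
    serves the adjacency scan, is off. The flag [false] accumulates a disjunction. *)
Definition home (G : graph) w : data :=
  Data (fun f => if f then false else w.1) (size (encode_graph G)) w.2.

Definition state (G : graph) e w : tapes role :=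
  raw (tag G) (encode_graph G) e (home G w).

Definition good (Z : seq X) (n : nat) e : Prop :=
  bounded n e /\ {in Z, forall z, e z = 0}.

(** The cost of the test is kept apart from the cost [t] of the continuation, so nested tests merely
    add up, even where a continuation is duplicated in the program. *)
Definition decides (K : frag -> frag -> frag) (q : graph -> env -> bool) : Prop :=
  exists2 T, polynomial T & forall G e w A B Z (t : nat),
    good [:: tmp; u; v] (tag G) e ->
    runs (if q G e then A else B) (state G e w) Z t ->
    runs (K A B) (state G e w) Z (T (tag G) + t).

Lemma decides_eq x y : x != tmp -> y != tmp ->
  decides (ceq x y) (fun _ e => e x == e y).
Proof.
move=> xt yt; exists eq_time.
  apply: (@polynomial_le _ (fun n => 7 * n.+1)) => [n|].
    by rewrite /eq_time; lia.
  exact: polynomialM (polynomial_const _) polynomialS.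
by move=> G e w A B Z t [be e0]; apply: runs_ceq => //; apply: e0; rewrite inE eqxx.
Qed.

Lemma decides_true : decides (fun A _ => A) (fun _ _ => true).
Proof. by exists (fun=> 0); first exact: polynomial_const. Qed.

Lemma decides_not K q :
  decides K q -> decides (fun A B => K B A) (fun G e => ~~ q G e).
Proof.
case=> T pT H; exists T => // G e w A B Z t ge r; apply: H => //.
by rewrite -if_neg.
Qed.

Lemma decides_and K K' q q' : decides K q -> decides K' q' ->
  decides (fun A B => K (K' A B) B) (fun G e => q G e && q' G e).
Proof.
case=> T pT H [T' pT' H']; exists (fun n => T n + T' n); first exact: polynomialD.
move=> G e w A B Z t ge r; rewrite -addnA; apply: H => //.
case: (q G e) r => /= r; first exact: H'.
by apply: runs_le r; rewrite leq_addl.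
Qed.

Lemma decides_ext K q q' : (forall G e, q G e = q' G e) -> decides K q -> decides K q'.
Proof.
by move=> ext [T pT H]; exists T => // G e w A B Z t; rewrite -ext; apply: H.
Qed.

Lemma decides_or K K' q q' : decides K q -> decides K' q' ->
  decides (fun A B => K A (K' A B)) (fun G e => q G e || q' G e).
Proof.
(* De Morgan: the swaps of continuations compute to the fragment in the statement. *)
move=> dK dK'; have := decides_not (decides_and (decides_not dK) (decides_not dK')).
by apply: decides_ext => G e; rewrite negb_and !negbK.
Qed.

Lemma decides_all (I : eqType) (r : seq I) (q : I -> graph -> env -> bool) :
  (forall i, i \in r -> exists K, decides K (q i)) ->
  exists K, decides K (fun G e => all (fun i => q i G e) r).
Proof.
elim: r => [|i r IH] H; first by exists (fun A _ => A); apply: decides_true.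
have [K dK] := H i (mem_head _ _).
have [K' dK'] := IH (fun j jr => H j (mem_behead (s := i :: r) jr)).
by eexists; apply: decides_and dK dK'.
Qed.

Section Adjacent.

Variables (G : graph) (e : env) (x y : X).

Notation n := (tag G).

(* The value of the flag when the head scans cell [k] of the input, moving left. *)
Let found (k : nat) : bool :=
  [exists i : 'I_n, exists j : 'I_n,
    [&& i.+1 == e x, j.+1 == e y, [set i; j] \in edges (tagged G)
      & k <= n.+1 + i * n + j]].

Let found_start : found n.+1 = adjacent G (e x) (e y).
Proof.
by apply/eq_existsb => i; apply/eq_existsb => j; rewrite -addnA leq_addr andbT.
Qed.

Let found_end : found (size (encode_graph G)) = false.
Proof.
apply/existsP => -[i /existsP [j /and4P [_ _ _]]].
rewrite size_encode_graph -addnA leq_add2l.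
by have := ltn_ord i; have := ltn_ord j; nia.
Qed.

(** A row-major position determines its row and column, because columns stay below [n]; hence only
    one pair comes into reach with the new cell. *)
Let found_step (i j : 'I_n) : found (n.+1 + i * n + j) =
  [&& [set i; j] \in edges (tagged G), i.+1 == e x & j.+1 == e y]
    || found (n.+1 + i * n + j).+1.
Proof.
apply/idP/orP => [|[/and3P [ij xi yj]|]].
- move=> /existsP [i' /existsP [j' /and4P [xi yj ij le]]].
  move: le; rewrite leq_eqVlt => /orP [eqk|lt]; last first.
    by right; apply/existsP; exists i'; apply/existsP; exists j'; apply/and4P.
  left; have [ei ej] : i = i' /\ j = j'.
    have lj := ltn_ord j; have lj' := ltn_ord j'.
    have eqij : i = i' :> nat by nia.
    split; first exact: val_inj.
    by apply: val_inj => /=; move: eqk; rewrite eqij; lia.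
  by rewrite ei ej ij xi.
- by apply/existsP; exists i; apply/existsP; exists j; rewrite xi yj ij leqnn.
- move=> /existsP [i' /existsP [j' /and4P [xi yj ij le]]].
  by apply/existsP; exists i'; apply/existsP; exists j'; rewrite xi yj ij ltnW.
Qed.

Lemma runs_cadj w A B Z t :
  x \notin [:: tmp; u; v] -> y \notin [:: tmp; u; v] ->
  good [:: tmp; u; v] n e ->
  runs (if adjacent G (e x) (e y) then A else B) (state G e w) Z t ->
  runs (cadj x y A B) (state G e w) Z
    (for_time n (for_time n (eq_time n + (eq_time n + 3))) + (n * n * 2 + 3 + t)).
Proof.
rewrite !inE !negb_or => /and3P [xt xu xv] /and3P [yt yu yv] [be e0] rAB.
have [tu tv uv] := neq_special.
have le_time m : 1 + (m + (m + 1)).+1 <= m + (m + 3) by clear; lia.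
pose s := encode_graph G.
pose D k : data := Data (fun f => if f then found k else w.1) k w.2.
have test (i j : 'I_n) : let k := n.+1 + i * n + j in
    let e' := upd (upd e u i.+1) v j.+1 in
    runs (bit_test x y) (raw n s e' (D k.+1)) (raw n s e' (D k))
      (eq_time n + (eq_time n + 3)).
  move=> k e'.
  have lk : k < size s.
    by rewrite size_encode_graph /k -addnA ltn_add2l index_lt.
  have be' : bounded n e' by do 2![apply: bounded_upd; first exact: leqW].
  have e'0 : e' tmp = 0.
    by rewrite !updE (negbTE tu) (negbTE tv) e0 // inE eqxx.
  pose p1 := Data (flag (D k.+1)) k w.2.
  have t1 : runs (imove X Left) (raw n s e' (D k.+1)) (raw n s e' p1) 1.
    exact: runs_ileft.
  have stop m : found k = found k.+1 ->
      runs (nop X) (raw n s e' p1) (raw n s e' (D k)) m.+1.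
    move=> fk; apply: (@runs_le _ _ _ _ 1) => //.
    have -> : raw n s e' (D k) = raw n s e' p1 by apply: raw_ext => // -[]; rewrite /= ?fk.
    exact: runs_nop.
  have e'u : e' u = i.+1 by rewrite !updE eqxx (negbTE uv).
  have e'v : e' v = j.+1 by rewrite !updE eqxx.
  have e'x : e' x = e x by rewrite !updE (negbTE xu) (negbTE xv).
  have e'y : e' y = e y by rewrite !updE (negbTE yu) (negbTE yv).
  have := found_step i j; rewrite -/k => fs.
  apply: runs_le (le_time (eq_time n)) _.
  apply: runs_seq t1 (runs_if _).
  have bitT b : (bit b == bit true) = b by case: b.
  rewrite reads_bitE (nth_map false) //= bitT nth_encode_graph.
  move: fs; case: (_ \in _) => /= fs; last by rewrite !addnS; apply: stop.
  apply: runs_ceq => //; first by rewrite eq_sym.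
  rewrite e'u e'x; move: fs; case: eqP => _ /= fs; last by rewrite addnS; apply: stop.
  apply: runs_ceq => //; first by rewrite eq_sym.
  rewrite e'v e'y; move: fs; case: eqP => _ /= fs; last exact: stop.
  have -> : raw n s e' (D k) = raw n s e' (with_flag p1 true true).
    by apply: raw_ext => // -[]; rewrite /= ?fs.
  exact: runs_setflag.
(* The scan stops at cell [n.+1], the first one behind the prefix 1^n 0. *)
have scan : runs (for_ u false (for_ v false (bit_test x y))) (state G e w)
    (raw n s e (D n.+1)) (for_time n (for_time n (eq_time n + (eq_time n + 3)))).
  have := @runs_for _ n s u false (for_ v false (bit_test x y)) e
    (fun i => D (n.+1 + i * n)) (for_time n (eq_time n + (eq_time n + 3))).
  rewrite mul0n !addn0.
  have -> : raw n s e (D (n.+1 + n * n)) = state G e w.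
    rewrite -size_encode_graph; apply: raw_ext => // -[] //=.
  apply=> // [|i li]; first by apply: e0; rewrite !inE eqxx orbT.
  have := @runs_for _ n s v false (bit_test x y) (upd e u i.+1)
    (fun j => D (n.+1 + i * n + j)) (eq_time n + (eq_time n + 3)).
  rewrite !addn0 -addnA -mulSnr; apply=> [||j lj].
  - by apply: bounded_upd be; apply: leqW.
  - by rewrite updE eq_sym (negbTE uv) e0 // !inE eqxx !orbT.
  - by rewrite addnS; apply: (test (Ordinal li) (Ordinal lj)).
have rewind : runs (fwhile (fun r => ~~ reads_bit None r) (imove X Right))
    (raw n s e (D n.+1))
    (raw n s e (Data (flag (D n.+1)) (size s) w.2)) (n * n * 2).+1.
  have := @runs_while _ (fun r => ~~ reads_bit None r) (imove X Right) 1
    (fun i => raw n s e (Data (flag (D n.+1)) (size s - i) w.2)) (n * n).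
  rewrite subn0 [size s - _](_ : _ = n.+1); last by rewrite size_encode_graph addnK.
  apply=> [i li|]; last by rewrite reads_bitE /= nth_default ?size_map.
  have ls : i < size s by rewrite size_encode_graph ltn_addl.
  have ltS : size s - i.+1 < size s by rewrite subnS prednK ?subn_gt0 ?leq_subr.
  split; first by rewrite reads_bitE (nth_map false).
  rewrite subnS; have := @runs_iright _ n s e (flag (D n.+1)) (size s - i).-1 w.2.
  by rewrite prednK ?subn_gt0 //; apply; apply: leq_subr.
apply: runs_seq scan _.
apply: (@runs_le _ _ _ _ ((n * n * 2).+1 + (1 + t).+1)); first by clear; lia.
apply: runs_seq rewind (runs_if _); rewrite is_setE /= found_start.
have fs := found_start; move: rAB fs; case: adjacent => rAB fs.
  apply: runs_seq rAB.
  have := @runs_setflag _ n s true false e (Data (flag (D n.+1)) (size s) w.2).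
  by congr runs; apply: raw_ext => // -[].
by apply: (@runs_le _ _ _ _ t).
Qed.

End Adjacent.

Lemma decides_adj x y : x \notin [:: tmp; u; v] -> y \notin [:: tmp; u; v] ->
  decides (cadj x y) (fun G e => adjacent G (e x) (e y)).
Proof.
move=> xs ys; exists (fun n =>
  for_time n (for_time n (eq_time n + (eq_time n + 3))) + (n * n * 2 + 3)).
  have pe : polynomial eq_time.
    apply: (@polynomial_le _ (fun n => 7 * n.+1)) => [n|].
      by rewrite /eq_time; lia.
    exact: polynomialM (polynomial_const _) polynomialS.
  apply: polynomialD.
    do 2![apply: polynomial_for]; apply: (polynomialD pe).
    exact: polynomialD pe (polynomial_const _).
  apply: (@polynomial_le _ (fun n => n.+1 * n.+1 * 2 + 3)) => [n|]; first by nia.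
  apply: polynomialD (polynomial_const _); apply: polynomialM (polynomial_const _).
  exact: polynomialM polynomialS polynomialS.
move=> G e w A B Z t ge r; rewrite -addnA; exact: runs_cadj.
Qed.

End Conditions.

(** * Printing tables *)

Section Loops.

Variables (X : finType) (tmp u v : X).

Notation role := (option (option (X + bool))).
Notation frag := (frag role).
Notation env := {ffun X -> nat}.

Implicit Types (e : env) (x y : X) (A B F : frag) (w : bool * seq bool).

Local Notation special := [:: tmp; u; v].
Local Notation action := (graph -> env -> bool * seq bool -> bool * seq bool).

(** The fragment is summarised by a function of flag and output. It restores the environment; [zs]
    contains the counters that it needs at 0. *)
Definition does (zs : seq X) F (g : action) : Prop :=
  exists2 T, polynomial T & forall G e w, good zs (tag G) e ->
    runs F (state G e w) (state G e (g G e w)) (T (tag G)).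

Lemma does_seq zs F F' g g' : does zs F g -> does zs F' g' ->
  does zs (fseq F F') (fun G e w => g' G e (g G e w)).
Proof.
move=> [T pT H] [T' pT' H']; exists (fun n => T n + T' n).
  exact: polynomialD.
by move=> G e w ge; apply: runs_seq (H _ _ _ ge) (H' _ _ _ ge).
Qed.

Lemma does_nop zs : does zs (nop X) (fun _ _ w => w).
Proof.
by exists (fun=> 1) => [|G e w _]; [exact: polynomial_const|exact: runs_nop].
Qed.

Lemma does_setflag zs b :
  does zs (setflag X false b) (fun _ _ w => (b, w.2)).
Proof.
exists (fun=> 1) => [|G e w _]; first exact: polynomial_const.
have -> : state G e (b, w.2) = raw (tag G) (encode_graph G) e
    (with_flag (home G w) false b) by apply: raw_ext => // -[].
exact: runs_setflag.
Qed.

Lemma does_emit zs b : does zs (emit X b) (fun _ _ w => (w.1, b :: w.2)).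
Proof.
by exists (fun=> 1) => [|G e w _]; [exact: polynomial_const|exact: runs_emit].
Qed.

Lemma does_if_flag zs F F' g g' : does zs F g -> does zs F' g' ->
  does zs (fif (is_set false) F F')
    (fun G e w => if w.1 then g G e w else g' G e w).
Proof.
move=> [T pT H] [T' pT' H']; exists (fun n => T n + T' n + 1).
  by apply: polynomialD (polynomial_const 1); apply: polynomialD.
move=> G e w ge; rewrite addn1; apply: runs_if; rewrite is_setE /=.
by case: (w.1); [apply: runs_le (H _ _ _ ge)|apply: runs_le (H' _ _ _ ge)];
  rewrite ?leq_addr ?leq_addl.
Qed.

Lemma does_cond K q F F' g g' : decides tmp u v K q ->
  does special F g -> does special F' g' ->
  does special (K F F') (fun G e w => if q G e then g G e w else g' G e w).
Proof.
move=> [T0 pT0 K0] [T pT H] [T' pT' H']; exists (fun n => T0 n + (T n + T' n)).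
  by apply: polynomialD => //; apply: polynomialD.
move=> G e w ge; apply: K0 => //.
by case: (q G e); [apply: runs_le (H _ _ _ ge)|apply: runs_le (H' _ _ _ ge)];
  rewrite ?leq_addr ?leq_addl.
Qed.

(* Loops run downwards: [foldr] handles the last index first. *)
Definition loop1 (full : bool) x (g : action) : action :=
  fun G e w => foldr (fun i => g G (upd e x i)) w (iota 1 (tag G + full)).

Lemma does_for zs full x F g : x \notin zs -> does zs F g ->
  does (x :: zs) (for_ x full F) (loop1 full x g).
Proof.
move=> xzs [T pT H]; exists (fun n => for_time n (T n)); first exact: polynomial_for.
move=> G e w [be e0]; set m := tag G + full.
(* The data once all indices above [i] have been treated. *)
pose S i := home G (foldr (fun i => g G (upd e x i)) w (iota i.+1 (m - i))).
have := @runs_for _ (tag G) (encode_graph G) x full F e S (T (tag G)) be.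
rewrite /S -/m subnn subn0 /= -/m; apply=> [|i im]; first by rewrite e0 ?mem_head.
rewrite (_ : m - i = (m - i.+1).+1) /=; last by rewrite -subSn ?subSS.
apply: (H); split=> [|z zz].
  by apply: bounded_upd be; move: im; rewrite /m; case: (full); lia.
rewrite updE; case: eqP zz => [->|_] zz; first by rewrite zz in xzs.
by apply: e0; rewrite inE zz orbT.
Qed.

Definition fors (full : bool) (xs : seq X) F : frag :=
  foldr (fun x => for_ x full) F xs.
Definition loop (full : bool) (xs : seq X) (g : action) : action :=
  foldr (loop1 full) g xs.

Lemma does_fors zs full xs F g : uniq (xs ++ zs) -> does zs F g ->
  does (xs ++ zs) (fors full xs F) (loop full xs g).
Proof.
elim: xs => //= x xs IH /andP [xn un] H; exact: does_for (IH un H).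
Qed.

Fixpoint exists_values (n : nat) (xs : seq X) (q : env -> bool) e : bool :=
  if xs is x :: xs' then has (fun i => exists_values n xs' q (upd e x i)) (iota 1 n)
  else q e.

Fixpoint table (n : nat) (xs : seq X) (q : env -> bool) e : seq bool :=
  if xs is x :: xs' then
    flatten [seq table n xs' q (upd e x i) | i <- iota 1 n.+1]
  else [:: q e].

Lemma loop_exists xs (q : graph -> env -> bool) G e w :
  loop false xs (fun G e w => (w.1 || q G e, w.2)) G e w =
  (w.1 || exists_values (tag G) xs (q G) e, w.2).
Proof.
elim: xs e w => //= x xs IH e w; rewrite /loop1 addn0.
elim: (iota _ _) => [|i r IHr] /=; first by rewrite orbF; case: (w).
by rewrite IHr [LHS]IH /= -orbA [has _ _ || _]orbC.
Qed.

Lemma loop_table xs (q : graph -> env -> bool) G e o :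
  loop true xs (fun G e w => (false, (w.1 || q G e) :: w.2)) G e (false, o) =
  (false, table (tag G) xs (q G) e ++ o).
Proof.
elim: xs e o => // x xs IH e o.
rewrite [LHS]/(loop1 _ _ _ _ _ _) /loop1 addn1 [table _ _ _ _]/(flatten _).
elim: (iota _ _) => //= i r IHr.
by rewrite IHr [LHS]IH catA.
Qed.

Definition prints F (b : graph -> seq bool) : Prop :=
  exists2 T, polynomial T & forall G o,
    runs F (state G [ffun=> 0] (false, o)) (state G [ffun=> 0] (false, b G ++ o))
      (T (tag G)).

Lemma does_prints zs F g b :
  (forall G o, g G [ffun=> 0] (false, o) = (false, b G ++ o)) ->
  does zs F g -> prints F b.
Proof.
move=> gb [T pT H]; exists T => // G o; rewrite -gb; apply: H.
by split=> [z|z _]; rewrite ffunE.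
Qed.

(** The flag carries the result of the search over [vs] to the printed bit. It is cleared before a 1
    is written, so every entry starts with the flag off. *)
Definition print_table (ws vs : seq X) (K : frag -> frag -> frag) : frag :=
  fors true ws
    (fseq (fors false vs (K (setflag X false true) (nop X)))
       (fif (is_set false) (fseq (setflag X false false) (emit X true))
          (emit X false))).

Lemma loop_ext full xs (g g' : action) :
  (forall G e w, g G e w = g' G e w) ->
  forall G e w, loop full xs g G e w = loop full xs g' G e w.
Proof.
move=> ext; elim: xs => //= x xs IH G e w; rewrite /loop1.
by elim: (iota _ _) => //= i r ->; rewrite IH.
Qed.

Lemma prints_table ws vs K q :
  uniq (ws ++ vs ++ special) -> decides tmp u v K q ->
  prints (print_table ws vs K)
    (fun G => table (tag G) ws (exists_values (tag G) vs (q G)) [ffun=> 0]).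
Proof.
move=> uwv dK; have := uwv; rewrite cat_uniq => /and3P [_ _ uv].
have step := does_fors false uv
  (does_cond dK (does_setflag special true) (does_nop special)).
have emits := does_if_flag (does_seq (does_setflag (vs ++ special) false)
   (does_emit _ true)) (does_emit _ false).
have := does_fors true uwv (does_seq step emits).
apply: does_prints => G o.
rewrite -(loop_table ws (fun G => exists_values (tag G) vs (q G))).
apply: loop_ext => {o}{}G e w.
rewrite (@loop_ext _ _ _ (fun G e w => (w.1 || q G e, w.2))) ?loop_exists /=.
  by case: (_ || _).
by move=> G' e' [a o] /=; case: (q _ _); rewrite ?orbT ?orbF.
Qed.

Lemma prints_emit b : prints (emit X b) (fun=> [:: b]).
Proof. by apply: does_prints (does_emit [::] b). Qed.

(** The fragment for the second part runs first, since the output grows to the left. *)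
Lemma prints_seq F F' b b' : prints F b -> prints F' b' ->
  prints (fseq F' F) (fun G => b G ++ b' G).
Proof.
move=> [T pT H] [T' pT' H']; exists (fun n => T' n + T n).
  exact: polynomialD.
by move=> G o; rewrite -catA; apply: runs_seq (H' G o) (H G _).
Qed.

Lemma prints_flatten (I : Type) (r : seq I) (F : I -> frag) b :
  (forall i, prints (F i) (b i)) ->
  prints (foldr (fun i P => fseq P (F i)) (nop X) r)
    (fun G => flatten [seq b i G | i <- r]).
Proof.
move=> H; elim: r => [|i r IH] /=; last exact: prints_seq (H i) IH.
by apply: does_prints (does_nop [::]).
Qed.

End Loops.

(** * From fragments to machines *)

Section Compile.

Variable V : finType.

Notation role := (option (option V)).

(** The machine model prescribes [ord0] for the input and [ord_max] for the output; the remaining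
    tapes lie between them. *)
Definition role_of (i : 'I_#|V|.+2) : role :=
  omap (fun j => omap enum_val (unlift ord_max j)) (unlift ord0 i).

Definition tape_of (r : role) : 'I_#|V|.+2 :=
  match r with
  | None => ord0
  | Some None => lift ord0 ord_max
  | Some (Some x) => lift ord0 (lift ord_max (enum_rank x))
  end.

Lemma tape_ofK : cancel tape_of role_of.
Proof.
rewrite /role_of; case=> [[x|]|] /=; rewrite ?unlift_none ?liftK //=.
  by rewrite liftK /= enum_rankK.
by rewrite unlift_none.
Qed.

Lemma role_of_eq0 i : (role_of i == None) = (i == ord0).
Proof.
by rewrite /role_of; case: unliftP => [j ->|->] //; rewrite eq_sym (negbTE (neq_lift _ _)).
Qed.

Lemma role_of_max : role_of ord_max = Some None.
Proof. by rewrite -[RHS]tape_ofK /=; congr role_of; apply: val_inj. Qed.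

Definition machine (F : frag role) : turing_machine :=
  @TuringMachine #|V|.+1 void (option (fstate F)) (Some (fstart F))
    (fun s => s == None)
    (fun s r => match s with
       | None => (None, [ffun i => (r i, Stay)])
       | Some s => let: (o, a) := fdelta s [ffun q => r (tape_of q)] in
                   (o, [ffun i => a (role_of i)])
       end).

Definition tapes_of (T : tapes role) : {ffun 'I_#|V|.+2 -> tape void} :=
  [ffun i => T (role_of i)].

Lemma machine_exits F s T T' k : @exits role F s T T' k ->
  iter k (@step (machine F)) (Some s, tapes_of T) = (None, tapes_of T').
Proof.
have one s1 T1 : @step (machine F) (Some s1, tapes_of T1) =
    let: (o, a) := fdelta s1 (heads T1) in (o, tapes_of (move a T1)).
  rewrite /step /= (_ : [ffun q => _] = heads T1).
    by case: fdelta => o a; congr pair; apply/ffunP => i; rewrite !ffunE.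
  by apply/ffunP => q; rewrite !ffunE tape_ofK.
elim=> {s T T' k} [s T a e|s s' a T T' k e _ IH]; rewrite iterSr one e //.
Qed.

Definition input_tapes (x : seq bool) : tapes role :=
  [ffun r : role => if r is None then tape_of_seq [seq Some (inl b) | b <- x]
            else Tape [::] None [::]].

Lemma machine_init F x :
  init_config (machine F) x = (Some (fstart F), tapes_of (input_tapes x)).
Proof.
congr pair; apply/ffunP => i; rewrite !ffunE -role_of_eq0.
by case: (role_of i).
Qed.

Lemma computes_runs F x T t m : runs F (input_tapes x) T t -> t <= m ->
  computes_within (machine F) x
    (bit_prefix (tape_head (T (Some None)) :: tape_right (T (Some None)))) m.
Proof.
move=> [k kt e] tm; have km : k <= m by apply: leq_trans kt tm.
have run : iter m (@step (machine F)) (init_config (machine F) x) =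
    (None, tapes_of T).
  rewrite -(subnK km) iterD machine_init (machine_exits e).
  (* A halted configuration idles through the remaining [m - k] steps. *)
  by elim: (_ - _) => //= j ->.
by rewrite /computes_within run; split=> //; rewrite /output ffunE role_of_max.
Qed.

End Compile.

(** * Initialising the tapes *)

Section Setup.

Variables (X : finType) (tmp : X).

Notation role := (option (option (X + bool))).

(** The prefix 1^n is copied to all variable tapes at once, behind a listed blank and followed by 0.
    Afterwards all variables return in lockstep, so testing [tmp] alone is enough. *)
Definition setup : frag role :=
  fseq (fact (fun r c => if r is Some (Some (inl _)) then (None, Right)
                         else (c, Stay)))
    (fseq (fwhile (reads_bit (bit true))
             (fact (fun r c => match r with
                      | None => (c, Right)
                      | Some (Some (inl _)) => (bit true, Right)
                      | _ => (c, Stay)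
                      end)))
       (fseq (fact (fun r c => if r is Some (Some (inl _)) then (bit false, Stay)
                               else (c, Stay)))
          (fseq (fwhile (fun r => ~~ reads_bit None r) (imove X Right))
             (fwhile (fun r => ~~ is0 tmp r) (vmove predT pred0))))).

Lemma zipper_ruler n :
  zipper (ruler n) n.+1 = Tape (nseq n (bit true) ++ [:: None]) (bit false) [::].
Proof.
rewrite /zipper /= nth_rcons size_nseq ltnn eqxx drop_oversize ?size_rcons ?size_nseq //.
rewrite -cats1 take_size_cat ?size_nseq // rev_cons -cats1 rev_nseq.
by [].
Qed.

Lemma runs_setup n s' (s := nseq n true ++ false :: s') :
  runs setup (input_tapes (X + bool)%type s)
    (raw n s [ffun=> 0] (Data (fun=> false) (size s) [::]))
    (n * 4 + size s' * 2 + 11).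
Proof.
pose fill p vt : tapes role := [ffun r : role => match r with
  | None => zipper (map bit s) p
  | Some (Some (inl _)) => vt
  | _ => Tape [::] None [::]
  end].
have sz : size s = n + (size s').+1 by rewrite size_cat size_nseq.
have inp p vt c : reads_bit c (heads (fill p vt)) = (nth None (map bit s) p == c).
  by rewrite /reads_bit !ffunE.
have nthT i : i < n -> nth None (map bit s) i = bit true.
  move=> li; rewrite (nth_map false) ?sz ?ltn_addr // nth_cat size_nseq li nth_nseq.
  by rewrite li.
have nthF : nth None (map bit s) n = bit false.
  by rewrite (nth_map false) ?sz ?addnS ?ltnS ?leq_addr // nth_cat size_nseq ltnn subnn.
pose vt i := Tape (nseq i (bit true) ++ [:: None]) None [::].
have r1 : runs (fact (fun (r : role) c => if r is Some (Some (inl _)) then (None, Right)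
    else (c, Stay))) (input_tapes (X + bool)%type s) (fill 0 (vt 0)) 1.
  have := runs_act (fun (r : role) c => if r is Some (Some (inl _)) then (None, Right)
    else (c, Stay)) (input_tapes (X + bool)%type s).
  congr (runs _ _ _ _); apply/ffunP => -[[[x|f]|]|]; rewrite !ffunE //=.
  rewrite /tape_of_seq /zipper take0 /= -nth0 -drop1.
  by [].
have r2 : runs (fwhile (reads_bit (bit true))
    (fact (fun (r : role) c => match r with
                      | None => (c, Right)
                      | Some (Some (inl _)) => (bit true, Right)
                      | _ => (c, Stay)
                      end))) (fill 0 (vt 0)) (fill n (vt n)) (n * 2).+1.
  have := @runs_while role (reads_bit (bit true))
    (fact (fun (r : role) c => match r with
                      | None => (c, Right)
                      | Some (Some (inl _)) => (bit true, Right)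
                      | _ => (c, Stay)
                      end)) 1 (fun i => fill (n - i) (vt (n - i))) n.
  rewrite subnn subn0; apply=> [i li|]; last by rewrite inp nthF.
  have ln : n - i.+1 < n by rewrite subnS prednK ?subn_gt0 ?leq_subr.
  split; first by rewrite inp nthT.
  have -> : n - i = (n - i.+1).+1 by rewrite -subSn ?subSS.
  set j := n - i.+1; rewrite -/j in ln *.
  have := runs_act (fun (r : role) c => match r with
                      | None => (c, Right)
                      | Some (Some (inl _)) => (bit true, Right)
                      | _ => (c, Stay)
                      end) (fill j (vt j)).
  congr (runs _ _ _ _); apply/ffunP => -[[[x|f]|]|]; rewrite !ffunE //.
  by apply: zipper_right; rewrite size_map sz ltn_addr.
have r3 : runs (fact (fun (r : role) c => if r is Some (Some (inl _)) then
    (bit false, Stay) else (c, Stay))) (fill n (vt n)) (fill n (zipper (ruler n) n.+1)) 1.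
  have := runs_act (fun (r : role) c => if r is Some (Some (inl _)) then
    (bit false, Stay) else (c, Stay)) (fill n (vt n)).
  by congr (runs _ _ _ _); apply/ffunP => -[[[x|f]|]|]; rewrite !ffunE // zipper_ruler.
have r4 : runs (fwhile (fun r => ~~ reads_bit None r) (imove X Right))
    (fill n (zipper (ruler n) n.+1))
    (raw n s [ffun=> n.+1] (Data (fun=> false) (size s) [::])) ((size s').+1 * 2).+1.
  have := @runs_while role (fun r => ~~ reads_bit None r) (imove X Right) 1
    (fun i => fill (size s - i) (zipper (ruler n) n.+1)) (size s').+1.
  rewrite subn0 [size s - _](_ : _ = n); last by rewrite sz addnK.
  (* With the head on the blank behind the input, listing this blank or not gives the same tape. *)
  have <- : fill (size s) (zipper (ruler n) n.+1) =
      raw n s [ffun=> n.+1] (Data (fun=> false) (size s) [::]).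
    apply/ffunP => -[[[x|f]|]|]; rewrite !ffunE //= /input_tape /zipper -cats1.
    rewrite take_size_cat ?size_map // take_oversize ?size_map //.
    rewrite nth_cat nth_default ?size_map // ltnn subnn.
    by rewrite !drop_oversize // ?size_cat ?size_map ?addn1 /= ?size_nseq ?sz.
  apply=> [i li|]; last by rewrite inp nth_default ?size_map.
  have ls : i < size s by rewrite sz ltn_addl.
  have lt : size s - i.+1 < size s by rewrite subnS prednK ?subn_gt0 ?leq_subr.
  split; first by rewrite inp (nth_map false).
  have -> : size s - i = (size s - i.+1).+1 by rewrite -subSn ?subSS.
  set j := size s - i.+1; rewrite -/j in lt *.
  have := runs_act (fun (r : role) c => (c, if r is None then Right else Stay))
    (fill j (zipper (ruler n) n.+1)).
  congr (runs _ _ _ _); apply/ffunP => -[[[x|f]|]|]; rewrite !ffunE //.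
  by apply: zipper_right; rewrite size_map.
have r5 : runs (fwhile (fun r => ~~ is0 tmp r) (vmove predT pred0))
    (raw n s [ffun=> n.+1] (Data (fun=> false) (size s) [::]))
    (raw n s [ffun=> 0] (Data (fun=> false) (size s) [::])) (n.+1 * 2).+1.
  apply: (@runs_while role _ _ 1
    (fun i => raw n s [ffun=> i] (Data (fun=> false) (size s) [::]))) => [i li|].
    rewrite is0E ?ffunE => [|x]; last by rewrite ffunE.
    split=> //.
    have := @runs_vmove X n s predT pred0 [ffun=> i.+1] (Data (fun=> false) (size s) [::]).
    have eqi : [ffun x => if predT x then ([ffun=> i.+1] x).-1 else
        if pred0 x then ([ffun=> i.+1] x).+1 else [ffun=> i.+1] x]
        = [ffun=> i] :> {ffun X -> nat}.
      by apply/ffunP => x; rewrite !ffunE.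
    by rewrite eqi; apply=> x; rewrite ?ffunE /=.
  by rewrite is0E ?ffunE // => x; rewrite ffunE.
apply: runs_le (runs_seq r1 (runs_seq r2 (runs_seq r3 (runs_seq r4 r5)))).
by clear; lia.
Qed.

End Setup.

Lemma prints_computes (X : finType) (tmp : X)
    (F : frag (option (option (X + bool)))) (b : graph -> seq bool) :
  prints F b -> exists (M : turing_machine) (c d : nat), forall G : graph,
    computes_within M (encode_graph G) (b G) (c * size (encode_graph G) ^ d + c).
Proof.
move=> [T pT H].
pose role := option (option (X + bool)).
(* The printed word starts one cell to the right of the output head; this last move puts the head on
   its first bit. *)
pose a (r : role) (c : cell void) := (c, if r is Some None then Right else Stay).
have : polynomial (fun n => n * 4 + n * n * 2 + 11 + (T n + 1)).
  apply: polynomialD (polynomialD pT (polynomial_const 1)).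
  apply: (@polynomial_le _ (fun n => 17 * (n.+1 * n.+1))) => [n|]; first by nia.
  exact: polynomialM (polynomial_const _) (polynomialM polynomialS polynomialS).
move=> [c [d le]]; exists (machine (fseq (setup tmp) (fseq F (fact a)))), c, d => G.
have := @runs_setup X tmp (tag G)
  [seq [set i; j] \in edges (tagged G) | i <- enum 'I_(tag G), j <- enum 'I_(tag G)].
rewrite -/(encode_graph G) size_allpairs size_enum_ord => r1.
have r2 := H G [::]; rewrite cats0 in r2.
have r3 := runs_act a (state G [ffun=> 0] (false, b G)).
have := runs_seq r1 (runs_seq _ r3).
rewrite (_ : raw _ _ _ _ = state G [ffun=> 0] (false, [::])); last first.
  by apply: raw_ext => // -[].
move=> /(_ _ _ r2) r; have := computes_runs r; rewrite !ffunE.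
rewrite (_ : bit_prefix _ = b G); last first.
  rewrite (_ : _ :: _ = if b G is [::] then [:: None] else map bit (b G)).
    by case: (b G) => // x o; elim: (x :: o) => //= y o' ->.
  by case: (b G).
(* The encoding has at least n+1 bits, so a polynomial in n+1 is one in the input length. *)
apply; apply: leq_trans (le (tag G)) _; apply: leq_trans (leq_addr _ _).
rewrite leq_mul2l; case: (posnP d) => [->|d0]; first by rewrite orbT.
by rewrite leq_exp2r // size_encode_graph leq_addr orbT.
Qed.

(** * Correctness of the reduction *)

Section Embeddings.

Definition embedding (T U : finType) (H : graph_on T) (G : graph_on U)
    (f : T -> U) : Prop :=
  injective f /\ forall e : {set T}, (e \in edges H) = (f @: e \in edges G).

Lemma card_edge (T : finType) (G : graph_on T) e : e \in edges G -> #|e| = 2.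
Proof. by move=> eG; have /forall_inP/(_ _ eG)/eqP := valP G. Qed.

Lemma edgeP (T : finType) (G : graph_on T) e :
  e \in edges G -> exists a b, e = [set a; b].
Proof. by move=> /card_edge/eqP/cards2P [a [b [_ ->]]]; exists a, b. Qed.

Lemma imset_pair (T U : finType) (f : T -> U) a b :
  f @: [set a; b] = [set f a; f b].
Proof. by rewrite imsetU1 imset_set1. Qed.

Lemma embedding_pairs (T U : finType) (H : graph_on T) (G : graph_on U) (f : T -> U) :
  injective f ->
  (forall a b, ([set a; b] \in edges H) = ([set f a; f b] \in edges G)) ->
  embedding H G f.
Proof.
move=> injf fE; split=> // e; apply/idP/idP => [eH|eG].
  have [a [b ee]] := edgeP eH; by rewrite ee imset_pair -fE -ee.
have /eqP/cards2P [a [b [_ ee]]] : #|e| = 2 by rewrite -(card_imset _ injf) (card_edge eG).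
by rewrite ee fE -imset_pair -ee.
Qed.

Lemma surj_bijective (T U : finType) (f : T -> U) :
  injective f -> (forall y, y \in codom f) -> bijective f.
Proof.
move=> injf surf; apply: inj_card_bij => //; rewrite -(card_codom injf).
by apply: subset_leq_card; apply/subsetP => y _; apply: surf.
Qed.

Lemma isomorphic_embedding (T U : finType) (H : graph_on T) (G : graph_on U) :
  isomorphic H G -> exists f, embedding G H f.
Proof.
move=> /existsP [f /and3P [/injectiveP injf /forallP surf /forallP fE]].
have [g fK gK] := surj_bijective injf surf.
exists g; split=> [|e]; first exact: can_inj gK.
have /eqP -> := fE (g @: e).
by rewrite -imset_comp (eq_imset _ (g := id)) ?imset_id.
Qed.

Lemma embedding_comp (T U V : finType) (F : graph_on T) (H : graph_on U)
    (G : graph_on V) f g :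
  embedding F H f -> embedding H G g -> embedding F G (g \o f).
Proof.
by move=> [injf fE] [injg gE]; split=> [|e]; [exact: inj_comp|rewrite imset_comp -gE fE].
Qed.

(** Maps compose, whereas induced subgraphs up to isomorphism do so only awkwardly; transitivity is
    what transfers freeness to pullbacks. *)
Definition embeds (F G : cgraph) : Prop :=
  exists2 f : cvert F -> cvert G,
    embedding (cgraph_graph F) (cgraph_graph G) f &
    forall e, e \in edges (cgraph_graph F) ->
      cgraph_color F e = cgraph_color G (f @: e).

Lemma embeds_trans F H G : embeds F H -> embeds H G -> embeds F G.
Proof.
move=> [f ef cf] [g eg cg]; exists (g \o f); first exact: embedding_comp ef eg.
move=> e eF; have fe : f @: e \in edges (cgraph_graph H) by rewrite -(proj2 ef).
by rewrite cf // cg // -imset_comp.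
Qed.

Lemma cinduced_embeds F G :
  (exists S : {set cvert G}, cisomorphic (cinduced S) F) <-> embeds F G.
Proof.
split=> [[S /existsP [f]]|].
  move=> /and4P [/injectiveP injf /forallP surf /forallP fE /forall_inP fc].
  have [g fK gK] := surj_bijective injf surf.
  have gE (e : {set cvert F}) : f @: (g @: e) = e.
    by rewrite -imset_comp (eq_imset _ (g := id)) ?imset_id //.
  exists (val \o g).
    split=> [|e]; first by apply: inj_comp; [exact: val_inj|exact: can_inj gK].
    have := fE (g @: e); rewrite gE => /eqP <-.
    by rewrite inE -imset_comp.
  move=> e eF; have := fc (g @: e); rewrite gE => /(_ _)/eqP <-.
    by rewrite ffunE -imset_comp.
  by have := fE (g @: e); rewrite gE => /eqP ->.
move=> [f [injf fE] fc]; exists [set f x | x in cvert F].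
set S := [set f x | x in cvert F].
have fS x : f x \in S by apply: imset_f.
have exg (y : {y | y \in S}) : exists x, f x == val y.
  by have /imsetP [x _ ->] := valP y; exists x.
pose g : {ffun {y | y \in S} -> cvert F} := [ffun y => xchoose (exg y)].
have gK y : f (g y) = val y by rewrite ffunE; apply/eqP; apply: (xchooseP (exg y)).
have gE (e : {set {y | y \in S}}) : f @: (g @: e) = val @: e.
  by rewrite -imset_comp; apply: eq_imset => y /=; rewrite gK.
apply/existsP; exists g; apply/and4P; split.
- by apply/injectiveP => y z eyz; apply: val_inj; rewrite -!gK eyz.
- apply/forallP => x; apply/codomP; exists (Sub (f x) (fS x)).
  by apply: injf; rewrite gK.
- by apply/forallP => e; rewrite fE gE inE.
- apply/forall_inP => e; rewrite inE => eG; rewrite ffunE /= fc ?gE //.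
  by rewrite fE gE.
Qed.

(** Members of [Fs] are addressed by index because [cgraph] is given no decidable equality; the
    default [G] is never reached. *)
Lemma is_freeP (Fs : seq cgraph) G :
  reflect (forall i, i < size Fs -> ~ embeds (nth G Fs i) G) (is_free Fs G).
Proof.
apply: (iffP (all_nthP G)) => H i li.
  by have /forallP noS := H i li; move/cinduced_embeds => [S]; apply/negP.
apply/forallP => S; apply/negP => iso; apply: (H i li).
by apply/cinduced_embeds; exists S.
Qed.

End Embeddings.

Definition sym_graph (Fs : seq cgraph) (R : symbol (sigF Fs)) :
  {n : nat & graph_on 'I_n} := ssval R.

Lemma mem_structF (Fs : seq cgraph) (R : symbol (sigF Fs)) (t : (arity R).-tuple color) :
  (t \in structF Fs R) = (edges (tagged (sym_graph R)) != set0) &&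
    [exists c : coloring 'I_(tag (sym_graph R)),
       is_free Fs (CGraph (tagged (sym_graph R)) c)
       && (tval t == color_tuple (tagged (sym_graph R)) c)].
Proof. by rewrite ffunE /=; case: ifP => _; rewrite inE. Qed.

(** * Colourings of the graph and homomorphisms of the structure *)

Section Correctness.

Variables (Fs : seq cgraph) (n : nat) (G : graph_on 'I_n).

Notation M := n.+1.
Notation N := (M * M).

Definition matches (r c p q : nat) : bool :=
  ((r == p) && (c == q)) || ((r == q) && (c == p)).

(* Vertex [p] of the structure codes the pair [(p %/ n.+1, p %% n.+1)], so an
   edge of [G] has two codes; imposing the constraints on all of them makes it
   unnecessary to compare vertices. *)
Definition placement k m (L : graph_on 'I_k) (t : m.-tuple 'I_N) : Prop :=
  exists f : 'I_k -> 'I_n,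
    [/\ injective f,
        forall a b, ([set a; b] \in edges L) = ([set f a; f b] \in edges G)
      & forall (i : 'I_m) a b, [set a; b] = nth set0 (sorted_edges L) i ->
          matches (tnth t i %/ M) (tnth t i %% M) (f a) (f b)].

Lemma mem_sorted_edges k (L : graph_on 'I_k) e :
  (e \in sorted_edges L) = (e \in edges L).
Proof. by rewrite mem_sort mem_enum. Qed.

Lemma size_sorted_edges k (L : graph_on 'I_k) :
  size (sorted_edges L) = #|edges L|.
Proof. by rewrite size_sort cardE. Qed.

Lemma arity_edges (R : symbol (sigF Fs)) :
  edges (tagged (sym_graph R)) != set0 -> arity R = #|edges (tagged (sym_graph R))|.
Proof. by rewrite -card_gt0 => gt0; apply/maxn_idPr. Qed.


Lemma color_tuple_nth k m (L : graph_on 'I_k) (t : m.-tuple color)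
    (c : coloring 'I_k) :
  m = #|edges L| ->
  (forall i : 'I_m, tnth t i = c (nth set0 (sorted_edges L) i)) ->
  tval t = color_tuple L c.
Proof.
rewrite -size_sorted_edges => sz e.
apply: (@eq_from_nth _ (c set0)); first by rewrite size_map -sz size_tuple.
move=> i; rewrite size_tuple => li.
rewrite (nth_map set0) -?sz // -[i in RHS]/(val (Ordinal li)) -e.
by rewrite (tnth_nth (c set0)).
Qed.

Lemma symbol_embedding (R : symbol (sigF Fs)) F0 :
  exists2 i, i < size Fs & exists f,
    embedding (cgraph_graph (nth F0 Fs i)) (tagged (sym_graph R)) f.
Proof.
have : sym_graph R \in ell Fs by apply: ssvalP.
rewrite mem_ell => /(has_nthP F0) [i li iso]; exists i => //.
exact: isomorphic_embedding.
Qed.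

Definition code (i j : 'I_n) : 'I_N := insubd (Ordinal (isT : 0 < N)) (i * M + j).

Lemma codeE i j : (code i j %/ M = i) * (code i j %% M = j).
Proof.
have li := ltn_ord i; have lj := ltn_ord j.
have lt : i * M + j < N.
  by apply: index_lt; apply: leqW.
rewrite /code /= val_insubd lt divnMDl // modnMDl divn_small ?addn0 ?modn_small //;
  exact: leqW.
Qed.

(** A code with a coordinate [n] names no pair of vertices; its colour is arbitrary. *)
Definition code_color (c : coloring 'I_n) (l : 'I_N) : color :=
  if (insub (l %/ M), insub (l %% M)) is (Some i, Some j) then c [set i; j]
  else red.

Lemma code_colorE c (l : 'I_N) (i j : 'I_n) :
  matches (l %/ M) (l %% M) i j -> code_color c l = c [set i; j].
Proof.
by rewrite /code_color; case/orP => /andP [/eqP -> /eqP ->]; rewrite !valK // setUC.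
Qed.

Lemma color_tuple_pullback k m (L : graph_on 'I_k) (t : m.-tuple 'I_N)
    (h : 'I_N -> color) (c : coloring 'I_n) (f : 'I_k -> 'I_n) :
  m = #|edges L| ->
  (forall (i : 'I_m) a b, [set a; b] = nth set0 (sorted_edges L) i ->
     h (tnth t i) = c [set f a; f b]) ->
  tval (map_tuple h t) = color_tuple L [ffun e : {set _} => c (f @: e)].
Proof.
move=> em H; apply: color_tuple_nth => // i.
have [|a [b eab]] := @edgeP _ L (nth set0 (sorted_edges L) i).
  by rewrite -mem_sorted_edges mem_nth // size_sorted_edges -em.
by rewrite tnth_map (H i a b) // ffunE eab imset_pair.
Qed.

Lemma embeds_pullback k (L : graph_on 'I_k) (c : coloring 'I_n) f :
  embedding L G f -> embeds (CGraph L [ffun e : {set _} => c (f @: e)]) (CGraph G c).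
Proof. by move=> ef; exists f => //= e _; rewrite ffunE. Qed.

Variable A : structure_on (sigF Fs) 'I_N.
Hypothesis A_placement : forall R (t : (arity R).-tuple 'I_N),
  t \in A R <-> placement (tagged (sym_graph R)) t.

(** The pullback of [c] along a placement of [L] is again free, and it witnesses that the image
    tuple is allowed. An edgeless [L] has no placement: the member of [Fs] with this underlying
    graph would embed in [G] under any colouring. *)
Lemma coloring_hom (c : coloring 'I_n) :
  is_free Fs (CGraph G c) -> is_hom A (structF Fs) (code_color c).
Proof.
move=> /is_freeP free R t /A_placement [f [injf fE ft]].
have ef := embedding_pairs injf fE; rewrite mem_structF.
have [L0|ne] := eqVneq (edges (tagged (sym_graph R))) set0.
  have [i li [g eg]] := symbol_embedding R (CGraph G c); case: (free i li).
  exists (f \o g); first exact: embedding_comp eg ef.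
  by move=> e; rewrite (proj2 eg) L0 inE.
apply/existsP; exists [ffun e : {set _} => c (f @: e)]; apply/andP; split.
  apply/is_freeP => i li eL; apply: (free i li).
  set F0 := CGraph _ _ in eL; rewrite (set_nth_default F0) //.
  exact: embeds_trans eL (embeds_pullback c ef).
apply/eqP; apply: color_tuple_pullback; first exact: arity_edges.
by move=> i a b eab; apply: code_colorE; apply: ft.
Qed.

(** The orientation is whichever [enum] gives. The default also fills the single tuple entry of an
    edgeless [L]. *)
Definition edge_code (e : {set 'I_n}) : 'I_N :=
  if enum e is [:: i; j] then code i j else Ordinal (isT : 0 < N).

Lemma edge_codeP (a b : 'I_n) : a != b ->
  matches (edge_code [set a; b] %/ M) (edge_code [set a; b] %% M) a b.
Proof.
move=> neq; have : size (enum [set a; b]) = 2 by rewrite -cardE cards2 neq.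
have ue := enum_uniq [set a; b]; have me := mem_enum [set a; b].
rewrite /edge_code; case: (enum _) ue me => [|i [|j []]] //= ue me _.
have := me a; have := me b; rewrite !inE !eqxx orbT /= !codeE /matches.
move=> /orP bij /orP aij; case: aij neq => /eqP ->; case: bij => /eqP ->;
  by rewrite ?eqxx ?orbT.
Qed.

Lemma ell_pullback (F : cgraph) i F0 : i < size Fs -> F = nth F0 Fs i ->
  exists2 R : symbol (sigF Fs), tag (sym_graph R) = #|cvert F| &
    exists f : 'I_(tag (sym_graph R)) -> cvert F, exists g,
    [/\ embedding (tagged (sym_graph R)) (cgraph_graph F) f,
        embedding (cgraph_graph F) (tagged (sym_graph R)) g & cancel g f].
Proof.
move=> li eF; pose k := #|cvert F|.
pose E := [set e : {set 'I_k} | enum_val @: e \in edges (cgraph_graph F)].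
have Eok : [forall e in E, #|e| == 2].
  apply/forall_inP => e; rewrite inE => eE.
  by rewrite -(card_imset _ (@enum_val_inj _ _)) (card_edge eE).
pose L : graph_on 'I_k := exist _ E Eok.
have emb : embedding L (cgraph_graph F) enum_val.
  by split=> [|e]; [exact: enum_val_inj|rewrite /edges inE].
have gmb : embedding (cgraph_graph F) L enum_rank.
  split=> [|e]; first exact: enum_rank_inj.
  rewrite (proj2 emb) -imset_comp (eq_imset _ (g := id)) ?imset_id // => x /=.
  by rewrite enum_rankK.
have mL : Tagged (fun n => graph_on 'I_n) L \in ell Fs.
  rewrite mem_ell; apply/(has_nthP F0); exists i => //; rewrite -eF.
  apply/existsP; exists [ffun x => enum_val x]; apply/and3P; split.
  - by apply/injectiveP => x y; rewrite !ffunE => /enum_val_inj.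
  - by apply/forallP => y; apply/codomP; exists (enum_rank y); rewrite ffunE enum_rankK.
  - apply/forallP => e; rewrite (eq_imset _ (g := enum_val)) => [|x].
      by rewrite -(proj2 emb) eqxx.
    by rewrite ffunE.
exists (SeqSub mL) => //; exists enum_val, enum_rank; split=> //; exact: enum_rankK.
Qed.

(** A copy of [F] in the coloured [G] yields a placement of some [L] isomorphic to the graph of [F],
    with a tuple of chosen codes. Its image under [h] is the tuple of a free colouring of [L]. A
    tuple determines the colours of all edges, so this colouring agrees on edges with the pullback
    of [c], which contains [F]. *)
Lemma hom_coloring (h : 'I_N -> color) :
  is_hom A (structF Fs) h ->
  is_free Fs (CGraph G [ffun e => h (edge_code e)]).
Proof.
move=> hom; set c : coloring 'I_n := [ffun e => _].
apply/is_freeP => i li [f ef fc]; set F := nth _ _ _ in f ef fc.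
have [R _ [p [q [ep eq pK]]]] := ell_pullback li (erefl F).
pose L := tagged (sym_graph R); have eL := embedding_comp ep ef.
set r := f \o p in eL; have [injr rE] := eL.
pose t := [tuple edge_code (r @: nth set0 (sorted_edges L) i) | i < arity R].
have At : t \in A R.
  apply/A_placement; exists r; split=> // [a b|j a b eab].
    by rewrite rE imset_pair.
  rewrite tnth_mktuple -eab imset_pair; apply: edge_codeP; rewrite (inj_eq injr).
  (* An edge has two elements and the default [set0] has none, so neither is a singleton. *)
  apply/eqP => ab; move: eab; rewrite ab setUid => eb.
  have := cards1 b; rewrite eb.
  case: (ltnP j (size (sorted_edges L))) => [lj|ge].
    by rewrite (@card_edge _ L) // -mem_sorted_edges mem_nth.
  by rewrite nth_default // cards0.
have := hom R t At; rewrite mem_structF => /andP [ne /existsP [c0 /andP []]].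
move=> /is_freeP free0 /eqP tc0.
have tc : tval (map_tuple h t) = color_tuple L [ffun e : {set _} => c (r @: e)].
  apply: color_tuple_pullback; first exact: arity_edges.
  by move=> j a b eab; rewrite tnth_mktuple -eab imset_pair ffunE.
have ec : {in sorted_edges L, c0 =1 [ffun e : {set _} => c (r @: e)]}.
  by apply/eq_in_map; rewrite -[LHS]/(color_tuple L c0) -tc0 tc.
apply: (free0 i li).
rewrite (set_nth_default (CGraph G c)) //; exists q => // e eF /=.
rewrite fc // ec ?mem_sorted_edges; last by rewrite -(proj2 eq).
rewrite [RHS]ffunE -[in RHS]imset_comp /=; congr (fun_of_fin c _).
by apply: eq_imset => x; rewrite /= /r /= pK.
Qed.

Lemma correctness :
  (exists c : coloring 'I_n, is_free Fs (CGraph G c)) <->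
  (exists h : 'I_N -> color, is_hom A (structF Fs) h).
Proof.
split=> [[c free]|[h hom]]; first by exists (code_color c); apply: coloring_hom.
by exists [ffun e => h (edge_code e)]; apply: hom_coloring.
Qed.

End Correctness.

(** * The reduction *)

(** Two nested loops over coordinates amount to one loop over codes; the successors are the shift of
    stored values. *)
Lemma flatten_grid (T : Type) (F : nat -> nat -> seq T) M K :
  flatten [seq flatten [seq F i j | j <- iota 1 M] | i <- iota 1 K] =
  flatten [seq F (l %/ M).+1 (l %% M).+1 | l <- iota 0 (K * M)].
Proof.
elim: K => [|K IH] //; rewrite mulSnr iotaD map_cat flatten_cat -IH -[K.+1]addn1 iotaD.
rewrite map_cat flatten_cat /= cats0 add0n; congr (_ ++ flatten _).
rewrite -[K * M]addn0 iotaDl -[1]/(1 + 0) iotaDl -!map_comp.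
apply/eq_in_map => j; rewrite mem_iota add0n => /= ltj.
have M0 : 0 < M by apply: leq_ltn_trans ltj.
by rewrite add1n divnMDl // divn_small // addn0 modnMDl modn_small.
Qed.

Lemma size_words N k w : w \in words N k -> size w = k.
Proof.
elim: k w => [|k IH] w; first by rewrite inE => /eqP ->.
by rewrite /words iterS => /allpairsP [[i w'] /= [_ /IH sw ->]] /=; rewrite sw.
Qed.

Lemma card_words N k : size (words N k) = N ^ k.
Proof.
elim: k => [|k IH] //.
by rewrite /words iterS size_allpairs size_enum_ord -/(words N k) IH expnS.
Qed.

(** * Loop variables and words of codes *)

Section Assignments.

Variables (X : finType) (n : nat).

Notation env := {ffun X -> nat}.
Notation M := n.+1.

Implicit Type e : env.

Definition flat (ps : seq (X * X)) : seq X :=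
  flatten [seq [:: p.1; p.2] | p <- ps].

Fixpoint assign e (ps : seq (X * X)) (w : seq nat) : env :=
  match ps, w with
  | (r, c) :: ps, l :: w =>
      assign (upd (upd e r (l %/ M).+1) c (l %% M).+1) ps w
  | _, _ => e
  end.

(** The nesting order of the loops is the lexicographic order that the encoding of structures
    requires. *)
Lemma table_words ps (q : env -> bool) e :
  table n (flat ps) q e =
  [seq q (assign e ps (map val w)) | w <- words (M * M) (size ps)].
Proof.
elim: ps e => // -[r c] ps IH e.
rewrite /words iterS -/(words _ _) map_allpairs.
rewrite [LHS](flatten_grid (fun i j => table n (flat ps) q (upd (upd e r i) c j))).
rewrite -val_enum_ord -map_comp; congr flatten.
by apply: eq_map => l /=; rewrite IH.
Qed.

Lemma assign_notin e ps w x : x \notin flat ps -> assign e ps w x = e x.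
Proof.
elim: ps e w => [|[r c] ps IH] e [|l w] //.
rewrite !inE !negb_or => /and3P [xr xc xps] /=.
by rewrite IH // !updE (negbTE xr) (negbTE xc).
Qed.

Lemma assign_nth e ps w d i : uniq (flat ps) -> size w = size ps -> i < size ps ->
  let p := nth d ps i in let l := nth 0 w i in
  (assign e ps w p.1 = (l %/ M).+1) * (assign e ps w p.2 = (l %% M).+1).
Proof.
elim: ps e w i => [|[r c] ps IH] e [|l w] // [|i] //= /and3P [].
  rewrite inE negb_or => /andP [rc rps] cps up _ _.
  by rewrite !assign_notin // !updE !eqxx (negbTE rc).
by move=> _ _ up [sw] li; apply: IH.
Qed.

Lemma exists_valuesP vs (q : env -> bool) e :
  reflect (exists2 f : X -> nat, {in vs, forall x, 0 < f x <= n} &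
             q [ffun x => if x \in vs then f x else e x])
          (exists_values n vs q e).
Proof.
elim: vs e => [|x vs IH] e /=.
  have -> : q e = q [ffun x => if x \in [::] then 0 else e x].
    by congr q; apply/ffunP => x; rewrite ffunE.
  apply: (iffP idP) => [qe|[f _ qe]]; first by exists (fun=> 0).
  by apply: etrans qe; congr q; apply/ffunP => x; rewrite !ffunE.
apply: (iffP hasP) => [[i]|[f fn qf]].
  rewrite mem_iota => ltn1 /IH [f fn qf].
  exists (fun y => if y \in vs then f y else i) => [y|].
    by rewrite inE; case: ifP => [yvs _|_ _]; [apply: fn|lia].
  apply: etrans qf; congr q; apply/ffunP => y; rewrite !ffunE inE.
  by case: (y \in vs); rewrite ?orbT // orbF.
exists (f x); first by have := fn x (mem_head _ _); rewrite mem_iota; lia.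
apply/IH; exists f => [y yvs|]; first by apply: fn; rewrite inE yvs orbT.
apply: etrans qf; congr q; apply/ffunP => y; rewrite !ffunE inE.
by case: (y \in vs); rewrite ?orbT // orbF; case: eqP => // ->.
Qed.

End Assignments.

(** * A formula for placements *)

Section Formula.

Variables (I : finType) (m k : I -> nat) (L : forall R, graph_on 'I_(k R)).

(** Every symbol has its own variables: two for each tuple entry and one for each vertex of its
    graph. Of the five shared ones, three serve the tests and two count the unary prefix. *)
Definition var : finType :=
  ('I_5 + {R : I & ('I_(m R) * bool + 'I_(k R))%type})%type.

Notation env := {ffun var -> nat}.

Definition aux_var (i : 'I_5) : var := inl i.
Definition coord (R : I) (i : 'I_(m R)) (b : bool) : var :=
  inr (Tagged (fun R => 'I_(m R) * bool + 'I_(k R))%type (inl (i, b))).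
Definition vertex (R : I) (a : 'I_(k R)) : var :=
  inr (Tagged (fun R => 'I_(m R) * bool + 'I_(k R))%type (inr a)).

Notation tmp := (aux_var (@Ordinal 5 0 isT)).
Notation u := (aux_var (@Ordinal 5 1 isT)).
Notation v := (aux_var (@Ordinal 5 2 isT)).
Notation row := (aux_var (@Ordinal 5 3 isT)).
Notation col := (aux_var (@Ordinal 5 4 isT)).

Lemma coord_inj R : injective (fun p => @coord R p.1 p.2).
Proof.
move=> [i b] [j c] e; have eT := inr_inj e.
by have [-> ->] := eq_from_Tagged eT.
Qed.

Lemma vertex_inj R : injective (@vertex R).
Proof.
move=> a b e; have eT := inr_inj e.
by have [->] := eq_from_Tagged eT.
Qed.

Definition coords (R : I) : seq (var * var) :=
  [seq (coord i false, coord i true) | i <- enum 'I_(m R)].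
Definition vertices (R : I) : seq var :=
  [seq vertex a | a <- enum 'I_(k R)].

Lemma flat_coords R :
  flat (coords R) = [seq coord i b | i <- enum 'I_(m R), b <- [:: false; true]].
Proof. by rewrite /flat -map_comp. Qed.

Lemma uniq_vars R :
  uniq (flat (coords R) ++ vertices R ++ [:: tmp; u; v]).
Proof.
have special x : x \in [:: tmp; u; v] -> exists i, x = aux_var i.
  by rewrite !inE => /or3P [] /eqP ->; eexists.
rewrite cat_uniq flat_coords; apply/and3P; split.
- apply: allpairs_uniq; rewrite ?enum_uniq // => -[i b] [j c] _ _.
  exact: (@coord_inj R (i, b) (j, c)).
- apply/hasPn => x; rewrite mem_cat => /orP [/mapP [a _ ->]|/special [i ->]];
    by apply/negP => /allpairsP [p [_ _]].
- rewrite cat_uniq map_inj_uniq ?enum_uniq //=; last exact: vertex_inj.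
  by rewrite andbT; apply/norP; split; [|apply/norP; split; [|apply/norP; split]];
    apply/negP => // /mapP [].
Qed.

Definition fits (R : I) (G : graph) (e : env) : bool :=
  all (fun p =>
    [&& (p.1 != p.2) ==> (e (vertex p.1) != e (vertex p.2)),
        ([set p.1; p.2] \in edges (L R))
          == adjacent G (e (vertex p.1)) (e (vertex p.2))
      & all (fun i : 'I_(m R) => ([set p.1; p.2] == nth set0 (sorted_edges (L R)) i) ==>
          matches (e (coord i false)) (e (coord i true))
            (e (vertex p.1)) (e (vertex p.2))) (enum 'I_(m R))])
    (enum {: 'I_(k R) * 'I_(k R)}).

Let uniq_special : uniq [:: tmp; u; v].
Proof. by []. Qed.

(** Whatever concerns [L] alone is known when the program is built and only selects the fragment; at
    run time just equalities and adjacencies in [G] are tested. *)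
Lemma decides_fits R : exists K, decides tmp u v K (@fits R).
Proof.
apply: decides_all => -[a b] _ /=.
have va c : @vertex R c \notin [:: tmp; u; v] by [].
have vt c : @vertex R c != tmp by [].
have wt i c : @coord R i c != tmp by [].
have [K1 d1] : exists K, decides tmp u v K
    (fun _ (e : env) => (a != b) ==> (e (vertex a) != e (vertex b))).
  case: (a != b); last by exists (fun A _ => A); apply: decides_true.
  by eexists; apply/decides_not/(decides_eq uniq_special).
have [K2 d2] : exists K, decides tmp u v K (fun G (e : env) =>
    ([set a; b] \in edges (L R)) == adjacent G (e (vertex a)) (e (vertex b))).
  have dA := decides_adj uniq_special (va a) (va b).
  case: (_ \in _); first by eexists; apply: decides_ext dA => G e; rewrite eq_sym eqb_id.
  by eexists; apply: decides_ext (decides_not dA) => G e; rewrite eq_sym eqbF_neg.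
have [K3 d3] : exists K, decides tmp u v K (fun (_ : graph) (e : env) =>
    all (fun i : 'I_(m R) => ([set a; b] == nth set0 (sorted_edges (L R)) i) ==>
          matches (e (coord i false)) (e (coord i true))
            (e (vertex a)) (e (vertex b))) (enum 'I_(m R))).
  apply: decides_all => i _; case: (_ == _);
    last by exists (fun A _ => A); apply: decides_true.
  by eexists; apply: decides_or; apply: decides_and; apply: (decides_eq uniq_special).
by eexists; apply: decides_and d1 (decides_and d2 d3).
Qed.

Definition holds (R : I) (G : graph) (w : seq nat) : bool :=
  exists_values (tag G) (vertices R) (fits R G) (assign (tag G) [ffun=> 0] (coords R) w).

Lemma matchesS r c p q : matches r.+1 c.+1 p.+1 q.+1 = matches r c p q.
Proof. by rewrite /matches !eqSS. Qed.

Lemma adjacentE (G : graph) (i j : 'I_(tag G)) :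
  adjacent G i.+1 j.+1 = ([set i; j] \in edges (tagged G)).
Proof.
apply/existsP/idP => [[i' /existsP [j' /and3P [/eqP [ei] /eqP [ej] ]]]|ij].
  by rewrite (val_inj ei) (val_inj ej).
by exists i; apply/existsP; exists j; rewrite !eqxx.
Qed.

Lemma holdsP (G : graph) R (t : (m R).-tuple 'I_((tag G).+1 * (tag G).+1)) :
  holds R G (map val t) <-> placement (tagged G) (L R) t.
Proof.
rewrite /holds; set e0 := assign _ _ _ _.
have e0E i : (e0 (coord i false) = (tnth t i %/ (tag G).+1).+1) *
    (e0 (coord i true) = (tnth t i %% (tag G).+1).+1).
  pose d := (coord i false, coord i true).
  have := @assign_nth var (tag G) [ffun=> 0] (coords R) (map val t) d i.
  rewrite size_map size_tuple size_map size_enum_ord => /(_ _ erefl (ltn_ord i)).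
  rewrite (nth_map i) ?size_enum_ord // nth_ord_enum /= (nth_map (tnth t i)) ?size_tuple //.
  rewrite -tnth_nth; apply.
  by have := uniq_vars R; rewrite cat_uniq => /andP [].
have notv i b : (@coord R i b \in vertices R) = false by apply/negP => /mapP [].
have inv a : @vertex R a \in vertices R by apply: map_f; rewrite mem_enum.
split.
  move/exists_valuesP => [f fn /allP fit].
  have lt a : (f (@vertex R a)).-1 < tag G by have := fn _ (inv a); lia.
  have [phi fE] : exists phi : 'I_(k R) -> 'I_(tag G),
      forall a, f (vertex a) = (phi a).+1.
    exists (fun a => Ordinal (lt a)) => a /=.
    by rewrite prednK //; case/andP: (fn _ (inv a)).
  exists phi; split=> [a b eab|a b|i a b /eqP eab].
  - apply/eqP/negPn/negP => neq; have := fit (a, b); rewrite mem_enum => /(_ isT).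
    by rewrite /= neq !ffunE !inv !fE eab eqxx.
  - have := fit (a, b); rewrite mem_enum => /(_ isT) /and3P [_ /= + _].
    by rewrite !ffunE !inv !fE adjacentE => /eqP.
  - have := fit (a, b); rewrite mem_enum => /(_ isT) /and3P [_ _ /allP /(_ i)].
    by rewrite mem_enum /= eab !ffunE !inv !notv !e0E !fE matchesS; apply.
move=> [f [injf fE ft]].
pose g (x : var) := if [pick a | vertex a == x] is Some a then (f a).+1 else 0.
have gE a : g (@vertex R a) = (f a).+1.
  by rewrite /g; case: pickP => [b /eqP /vertex_inj -> //|/(_ a)]; rewrite eqxx.
apply/exists_valuesP; exists g => [x /mapP [a _ ->]|]; first by rewrite gE /= ltn_ord.
apply/allP => -[a b] _ /=; rewrite !ffunE !inv !gE; apply/and3P; split.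
- by apply/implyP; rewrite eqSS (inj_eq val_inj) (inj_eq injf).
- by rewrite adjacentE fE.
- apply/allP => i _; apply/implyP => /eqP eab.
  by rewrite !ffunE !notv !e0E matchesS; apply: ft.
Qed.

(** The domain size is written in unary as the table of a true condition over all codes. *)
Definition ones : frag (option (option (var + bool))) :=
  print_table [:: row; col] [::] (fun A _ => A).

Lemma prints_ones : prints ones (fun G => nseq ((tag G).+1 * (tag G).+1) true).
Proof.
have := @prints_table var tmp u v [:: row; col] [::] _ _ isT (@decides_true var tmp u v).
case=> T pT H; exists T => // G o; have := H G o.
rewrite (table_words (tag G) [:: (row, col)]); set W := words _ _.
rewrite (_ : map _ W = nseq (size W) true); last by elim: W => //= w W ->.
by rewrite card_words expn1.
Qed.

End Formula.

(** * Assembling the reduction *)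

Section Reduction.

Variable Fs : seq cgraph.

Notation arty := (@arity (sigF Fs)).

Let order (R : symbol (sigF Fs)) : nat := tag (sym_graph R).

Let shape (R : symbol (sigF Fs)) : graph_on 'I_(order R) :=
  tagged (sym_graph R).

Definition reduct (G : graph) : {n : nat & structure_on (sigF Fs) 'I_n} :=
  Tagged (fun n => structure_on (sigF Fs) 'I_n)
    ([ffun R => [set t : (arty R).-tuple 'I_((tag G).+1 * (tag G).+1) |
                  holds arty shape R G (map val t)]]
     : structure_on (sigF Fs) 'I_((tag G).+1 * (tag G).+1)).

Lemma reduct_correct (G : graph) :
  (exists c : coloring 'I_(tag G), is_free Fs (CGraph (tagged G) c)) <->
  (exists h : 'I_(tag (reduct G)) -> color, is_hom (tagged (reduct G)) (structF Fs) h).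
Proof. by apply: correctness => R t; rewrite ffunE inE holdsP. Qed.


Lemma reduct_computable :
  @polytime_computable (free_coloring_problem Fs) (CSP (structF Fs)) reduct.
Proof.
pose tables (R : symbol (sigF Fs)) (G : graph) :=
  [seq holds arty shape R G (map val w)
    | w <- words ((tag G).+1 * (tag G).+1) (arty R)].
pose V := var arty order.
have print R : exists F : frag (option (option (V + bool))), prints F (tables R).
  have [K dK] := decides_fits arty shape R.
  have := prints_table (uniq_vars arty _ R) dK.
  set F := print_table _ _ _; case=> T pT H; exists F, T => // G o.
  by have := H G o; rewrite table_words size_map size_enum_ord.
(* Finite choice over the symbols: one program contains a printing fragment for each of them. *)
have [F pF] := fin_all_exists print.
have pP := prints_seq (prints_ones arty order)
  (prints_seq (prints_emit _ false) (prints_flatten (enum (symbol (sigF Fs))) pF)).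
have [M [c [d H]]] := prints_computes (aux_var arty order (@Ordinal 5 0 isT)) pP.
exists M, c, d => G; have := H G.
congr computes_within.
congr (_ ++ _ :: flatten _); apply: eq_map => R.
apply/eq_in_map => w ww.
have sw := size_words ww; rewrite -[w]/(tval (Tuple (introT eqP sw))).
by rewrite (mem_image val_inj) ffunE inE.
Qed.

End Reduction.

Theorem lemma40 (Fs : seq cgraph) :
  polytime_reducible (free_coloring_problem Fs) (CSP (structF Fs)).
Proof.
exists (@reduct Fs); split; first exact: reduct_computable.
exact: reduct_correct.
Qed.
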